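(* Mumbling $H_\mu$ with basis $\mathit{LTL}$ and unique mumbling is strictly more expressive than stuttering $H_\mu$ with basis $\mathit{LTL}$ and unique stuttering.
   Context: Fix a finite set $\mathit{AP}$. A trace is an infinite sequence $P_0m_0P_1m_1\dots$ with $P_i\subseteq\mathit{AP}$, $m_i\in\{\mathit{int},\mathit{call},\mathit{ret}\}$; $\mathit{tr}(i)=P_i$. Successor functions: $\mathit{succ}_\mathsf{g}(\mathit{tr},i)=i+1$; $\mathit{succ}_\mathsf{a}(\mathit{tr},i)=i+1$ if $m_i=\mathit{int}$, and if $m_i=\mathit{call}$ the least $j>i$ such that among $m_i,\dots,m_{j-1}$ the numbers of $\mathit{call}$ and $\mathit{ret}$ coincide (undefined if none), undefined if $m_i=\mathit{ret}$; $\mathit{succ}_\mathsf{c}(\mathit{tr},i)$ the largest $j<i$ with $m_j=\mathit{call}$ such that among $m_{j+1},\dots,m_{i-1}$ the numbers of $\mathit{call}$ and $\mathit{ret}$ coincide (undefined if none). Mumbling $H_\mu$: trace formulae $\delta ::= \mathit{ap}\mid Y\mid\delta\lor\delta\mid\lnot\delta\mid\bigcirc^\mathsf{f}\delta\mid\mu Y.\delta$ ($\mathsf{f}\in\{\mathsf{g},\mathsf{a},\mathsf{c}\}$); multitrace formulae $\psi ::= [\delta]_\pi\mid X\mid\psi\lor\psi\mid\lnot\psi\mid\bigcirc^\Delta\psi\mid\mu X.\psi$ with $\Delta$ mapping trace variables to trace formulae; hyperproperty formulae $\varphi ::= \exists\pi.\varphi\mid\forall\pi.\varphi\mid\psi$;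 fixpoint variables occur positively; closed = all variables bound. Trace semantics $\llbracket\delta\rrbracket^{\mathit{tr}}_{\mathcal{V}}\subseteq\mathbb{N}_0$: $\mathit{ap}\mapsto\{i\mid\mathit{ap}\in\mathit{tr}(i)\}$, $Y\mapsto\mathcal{V}(Y)$, union, complement, $\bigcirc^\mathsf{f}\delta\mapsto\{i\mid\mathit{succ}_\mathsf{f}(\mathit{tr},i)$ defined and in $\llbracket\delta\rrbracket\}$, $\mu Y.\delta\mapsto\bigcap\{I\mid\llbracket\delta\rrbracket_{\mathcal{V}[Y\mapsto I]}\subseteq I\}$. $\mathit{succ}_\delta(\mathit{tr},i)=\min\{j>i\mid j\in\llbracket\delta\rrbracket^{\mathit{tr}}\}$ if nonempty, else $i+1$; $\mathit{succ}_\Delta(\Pi,v)$ componentwise for a trace assignment $\Pi$ on $\pi_1,\dots,\pi_n$. $\llbracket\psi\rrbracket^\Pi_{\mathcal{W}}\subseteq\mathbb{N}_0^n$: $[\delta]_{\pi_j}\mapsto\{v\mid v_j\in\llbracket\delta\rrbracket^{\Pi(\pi_j)}\}$, $X\mapsto\mathcal{W}(X)$, Boolean as usual, $\bigcirc^\Delta\psi\mapsto\{v\mid\mathit{succ}_\Delta(\Pi,v)\in\llbracket\psi\rrbracket\}$, $\mu X$ least fixpoint. $\Pi\models_\mathcal{T}\exists\pi.\varphi$ iff some $\mathit{tr}\in\mathcal{T}$ gives $\Pi[\pi\mapsto\mathit{tr}]\models_\mathcal{T}\varphi$; $\forall$ for all; $\Pi\models_\mathcal{T}\psi$ iff $(0,\dots,0)\in\llbracket\psi\rrbracket^\Pi$.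 For closed $\varphi$ and a set of traces $\mathcal{T}$, $\mathcal{T}\models\varphi$ iff the empty assignment satisfies $\varphi$ over $\mathcal{T}$. Stuttering $H_\mu$ is identical except that multitrace next operators are $\bigcirc^\Gamma\psi$ with $\Gamma$ mapping each trace variable to a finite set of trace formulae; for a finite set $\gamma$, $\mathit{succ}_\gamma(\mathit{tr},i)=\min\{j>i\mid$ for some $\delta\in\gamma$: $i\in\llbracket\delta\rrbracket^{\mathit{tr}}\not\Leftrightarrow j\in\llbracket\delta\rrbracket^{\mathit{tr}}\}$ if nonempty, else $i+1$; $\mathit{succ}_\Gamma$ componentwise and $\llbracket\bigcirc^\Gamma\psi\rrbracket=\{v\mid\mathit{succ}_\Gamma(\Pi,v)\in\llbracket\psi\rrbracket\}$. Unique mumbling (stuttering): all multitrace next operators use the same $\Delta$ ($\Gamma$). Base formulae: trace formulae occurring in tests $[\delta]_\pi$ or as values $\Delta(\pi)$ (elements of $\Gamma(\pi)$). Basis $\mathit{LTL}$: all base formulae are LTL formulae, i.e. built from atomic propositions using $\lnot$, $\lor$, $\bigcirc^\mathsf{g}$ and $\delta_1\,\mathcal{U}\,\delta_2:=\mu Y.(\delta_2\lor(\delta_1\land\bigcirc^\mathsf{g}Y))$ as the only fixpoint construct. $L_1$ is at least as expressive as $L_2$ if for every closed hyperproperty formula $\varphi$ of $L_2$ there is a closed $\varphi'$ of $L_1$ with $\mathcal{T}\models\varphi$ iff $\mathcal{T}\models\varphi'$ for all sets of traces $\mathcal{T}$; strictly more expressive means at least as expressive but not conversely. *)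

(* Defs.v *)
From mathcomp Require Import all_boot.
From Stdlib Require List.

Set Implicit Arguments.
Unset Strict Implicit.
Unset Printing Implicit Defensive.

Inductive move := MInt | MCall | MRet.

Definition is_call (m : move) : bool := if m is MCall then true else false.
Definition is_ret (m : move) : bool := if m is MRet then true else false.

(* Successor function kinds: global (g), abstract (a), caller (c). *)
Inductive sdir := DirG | DirA | DirC.

Section Hmu.
Variable AP : finType.

(* A trace P_0 m_0 P_1 m_1 ... ; tr(i) = P_i is the first component. *)
Definition trace := nat -> {set AP} * move.

Definition mv (tr : trace) (i : nat) : move := (tr i).2.

Definition ncall (tr : trace) (i j : nat) : nat :=
  \sum_(i <= k < j) (is_call (mv tr k) : nat).
Definition nret (tr : trace) (i j : nat) : nat :=
  \sum_(i <= k < j) (is_ret (mv tr k) : nat).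
Definition balanced (tr : trace) (i j : nat) : Prop := ncall tr i j = nret tr i j.

(* succ_f(tr, i) = j, as a (functional) relation; undefined = no j. *)
Definition succ_rel (f : sdir) (tr : trace) (i j : nat) : Prop :=
  match f with
  | DirG => j = i.+1
  | DirA =>
      (mv tr i = MInt /\ j = i.+1) \/
      (mv tr i = MCall /\ i < j /\ balanced tr i j /\
         forall k, i < k < j -> ~ balanced tr i k)
  | DirC =>
      j < i /\ mv tr j = MCall /\ balanced tr j.+1 i /\
      forall k, j < k < i -> mv tr k = MCall -> ~ balanced tr k.+1 i
  end.

Inductive tform :=
| TAp of AP
| TVar of nat
| TOr of tform & tform
| TNot of tform
| TNext of sdir & tform
| TMu of nat & tform.

Definition tAnd (d1 d2 : tform) : tform := TNot (TOr (TNot d1) (TNot d2)).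
Definition tUntil (Y : nat) (d1 d2 : tform) : tform :=
  TMu Y (TOr d2 (tAnd d1 (TNext DirG (TVar Y)))).

Definition upd {A : Type} (f : nat -> A) (x : nat) (a : A) : nat -> A :=
  fun y => if y == x then a else f y.

Fixpoint tsem (tr : trace) (V : nat -> nat -> Prop) (d : tform) {struct d}
  : nat -> Prop :=
  match d with
  | TAp a => fun i => a \in (tr i).1
  | TVar Y => V Y
  | TOr d1 d2 => fun i => tsem tr V d1 i \/ tsem tr V d2 i
  | TNot d1 => fun i => ~ tsem tr V d1 i
  | TNext f d1 => fun i => exists j, succ_rel f tr i j /\ tsem tr V d1 j
  | TMu Y d1 => fun i =>
      forall I : nat -> Prop,
        (forall k, tsem tr (upd V Y I) d1 k -> I k) -> I i
  end.

Definition emptyV : nat -> nat -> Prop := fun _ _ => False.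

Fixpoint tfree (Y : nat) (d : tform) : Prop :=
  match d with
  | TAp _ => False
  | TVar Y' => Y' = Y
  | TOr d1 d2 => tfree Y d1 \/ tfree Y d2
  | TNot d1 => tfree Y d1
  | TNext _ d1 => tfree Y d1
  | TMu Y' d1 => Y' <> Y /\ tfree Y d1
  end.

Fixpoint tocc_ok (Y : nat) (p : bool) (d : tform) : Prop :=
  match d with
  | TAp _ => True
  | TVar Y' => Y' = Y -> p = true
  | TOr d1 d2 => tocc_ok Y p d1 /\ tocc_ok Y p d2
  | TNot d1 => tocc_ok Y (~~ p) d1
  | TNext _ d1 => tocc_ok Y p d1
  | TMu Y' d1 => Y' = Y \/ tocc_ok Y p d1
  end.

Inductive isLTL : tform -> Prop :=
| LTL_ap a : isLTL (TAp a)
| LTL_not d : isLTL d -> isLTL (TNot d)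
| LTL_or d1 d2 : isLTL d1 -> isLTL d2 -> isLTL (TOr d1 d2)
| LTL_next d : isLTL d -> isLTL (TNext DirG d)
| LTL_until Y d1 d2 : isLTL d1 -> isLTL d2 -> isLTL (tUntil Y d1 d2).

(* Multitrace formulae, parameterised by the annotation K of next operators *)
(* (K = trace var -> trace formula for mumbling,                            *)
(*  K = trace var -> finite set (list) of trace formulae for stuttering).   *)
(* Trace variables and fixpoint variables are named by nat.                 *)

Inductive mform (K : Type) :=
| MTest of tform & nat
| MVar of nat
| MOr of mform K & mform K
| MNot of mform K
| MNext of K & mform K
| MMu of nat & mform K.

Arguments MTest {K}.
Arguments MVar {K}.

(* a trace assignment; positions v : trace var -> nat *)
Definition tassign := nat -> trace.
Definition mstep (K : Type) :=
  K -> tassign -> (nat -> nat) -> (nat -> nat) -> Prop.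

Fixpoint msem (K : Type) (step : mstep K) (Pi : tassign)
  (W : nat -> (nat -> nat) -> Prop) (psi : mform K) {struct psi}
  : (nat -> nat) -> Prop :=
  match psi with
  | MTest d pi => fun v => tsem (Pi pi) emptyV d (v pi)
  | MVar X => W X
  | MOr p1 p2 => fun v => msem step Pi W p1 v \/ msem step Pi W p2 v
  | MNot p1 => fun v => ~ msem step Pi W p1 v
  | MNext k p1 => fun v => exists w, step k Pi v w /\ msem step Pi W p1 w
  | MMu X p1 => fun v =>
      forall I : (nat -> nat) -> Prop,
        (forall u, msem step Pi (upd W X I) p1 u -> I u) -> I v
  end.

Definition next_after (P : nat -> Prop) (i j : nat) : Prop :=
  (i < j /\ P j /\ forall k, i < k < j -> ~ P k) \/
  ((forall k, i < k -> ~ P k) /\ j = i.+1).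

Definition mum_step : mstep (nat -> tform) :=
  fun Delta Pi v w =>
    forall pi, next_after (tsem (Pi pi) emptyV (Delta pi)) (v pi) (w pi).

Definition stut_step : mstep (nat -> list tform) :=
  fun Gamma Pi v w =>
    forall pi,
      next_after
        (fun j => exists d, List.In d (Gamma pi) /\
           ~ (tsem (Pi pi) emptyV d (v pi) <-> tsem (Pi pi) emptyV d j))
        (v pi) (w pi).

Fixpoint mfree (K : Type) (X : nat) (psi : mform K) : Prop :=
  match psi with
  | MTest _ _ => False
  | MVar X' => X' = X
  | MOr p1 p2 => mfree X p1 \/ mfree X p2
  | MNot p1 => mfree X p1
  | MNext _ p1 => mfree X p1
  | MMu X' p1 => X' <> X /\ mfree X p1
  end.

Fixpoint mocc_ok (K : Type) (X : nat) (p : bool) (psi : mform K) : Prop :=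
  match psi with
  | MTest _ _ => True
  | MVar X' => X' = X -> p = true
  | MOr p1 p2 => mocc_ok X p p1 /\ mocc_ok X p p2
  | MNot p1 => mocc_ok X (~~ p) p1
  | MNext _ p1 => mocc_ok X p p1
  | MMu X' p1 => X' = X \/ mocc_ok X p p1
  end.

Fixpoint mwf (K : Type) (psi : mform K) : Prop :=
  match psi with
  | MTest _ _ => True
  | MVar _ => True
  | MOr p1 p2 => mwf p1 /\ mwf p2
  | MNot p1 => mwf p1
  | MNext _ p1 => mwf p1
  | MMu X p1 => mocc_ok X true p1 /\ mwf p1
  end.

Fixpoint mall_tests (K : Type) (P : tform -> nat -> Prop) (psi : mform K) : Prop :=
  match psi with
  | MTest d pi => P d pi
  | MVar _ => True
  | MOr p1 p2 => mall_tests P p1 /\ mall_tests P p2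
  | MNot p1 => mall_tests P p1
  | MNext _ p1 => mall_tests P p1
  | MMu _ p1 => mall_tests P p1
  end.

Fixpoint mall_labels (K : Type) (Q : K -> Prop) (psi : mform K) : Prop :=
  match psi with
  | MTest _ _ => True
  | MVar _ => True
  | MOr p1 p2 => mall_labels Q p1 /\ mall_labels Q p2
  | MNot p1 => mall_labels Q p1
  | MNext k p1 => Q k /\ mall_labels Q p1
  | MMu _ p1 => mall_labels Q p1
  end.

Inductive hform (K : Type) :=
| HEx of nat & hform K
| HAll of nat & hform K
| HM of mform K.

Fixpoint hsat (K : Type) (step : mstep K) (T : trace -> Prop) (Pi : tassign)
  (phi : hform K) : Prop :=
  match phi with
  | HEx pi p => exists tr, T tr /\ hsat step T (upd Pi pi tr) p
  | HAll pi p => forall tr, T tr -> hsat step T (upd Pi pi tr) p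
  | HM psi => msem step Pi (fun _ _ => False) psi (fun _ => 0)
  end.

Definition default_trace : trace := fun _ => (set0, MInt).

(* T |= phi  (the empty assignment; unassigned variables are never read
   in closed formulas) *)
Definition models (K : Type) (step : mstep K) (T : trace -> Prop)
  (phi : hform K) : Prop :=
  hsat step T (fun _ => default_trace) phi.

Fixpoint hmatrix (K : Type) (phi : hform K) : mform K :=
  match phi with
  | HEx _ p => hmatrix p
  | HAll _ p => hmatrix p
  | HM psi => psi
  end.

Fixpoint htclosed (K : Type) (bound : nat -> Prop) (phi : hform K) : Prop :=
  match phi with
  | HEx pi p => htclosed (fun x => x = pi \/ bound x) p
  | HAll pi p => htclosed (fun x => x = pi \/ bound x) p
  | HM psi => mall_tests (fun _ pi => bound pi) psi
  end.

(* closed and well-formed hyperproperty formula (base formulae are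
   required to be LTL separately, which makes them closed and well-formed) *)
Definition hclosed_wf (K : Type) (phi : hform K) : Prop :=
  htclosed (fun _ => False) phi /\
  (forall X, ~ mfree X (hmatrix phi)) /\
  mwf (hmatrix phi).

Definition MumLTLUnique (phi : hform (nat -> tform)) : Prop :=
  hclosed_wf phi /\
  mall_tests (fun d _ => isLTL d) (hmatrix phi) /\
  exists Delta : nat -> tform,
    (forall pi, isLTL (Delta pi)) /\
    mall_labels (fun Delta' => forall pi, Delta' pi = Delta pi) (hmatrix phi).

Definition StutLTLUnique (phi : hform (nat -> list tform)) : Prop :=
  hclosed_wf phi /\
  mall_tests (fun d _ => isLTL d) (hmatrix phi) /\
  exists Gamma : nat -> list tform,
    (forall pi d, List.In d (Gamma pi) -> isLTL d) /\
    mall_labels (fun Gamma' => forall pi d, List.In d (Gamma' pi) <-> List.In d (Gamma pi))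
      (hmatrix phi).

End Hmu.

Definition at_least_as_expressive (AP : finType) (K1 K2 : Type)
  (step1 : mstep AP K1) (L1 : hform AP K1 -> Prop)
  (step2 : mstep AP K2) (L2 : hform AP K2 -> Prop) : Prop :=
  forall phi, L2 phi ->
    exists phi', L1 phi' /\
      forall T : trace AP -> Prop, models step1 T phi' <-> models step2 T phi.

Definition strictly_more_expressive (AP : finType) (K1 K2 : Type)
  (step1 : mstep AP K1) (L1 : hform AP K1 -> Prop)
  (step2 : mstep AP K2) (L2 : hform AP K2 -> Prop) : Prop :=
  at_least_as_expressive step1 L1 step2 L2 /\
  ~ at_least_as_expressive step2 L2 step1 L1.

(* Main.v *)
Require Import Defs.
From mathcomp Require Import all_boot.
From mathcomp Require Import boolp zify.

(** Stuttering to mumbling: the formula "some base formula differs between now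
    and the next position" marks the last position of each block on which the
    base formulae are constant, and the stuttering successor of [i + 1] is the
    mumbling successor of [i], plus one.  A stuttering position is therefore
    represented by a mumbling position off by one.  Only the initial position
    has no predecessor; it is never revisited, so it can be handled by
    unfolding the formula once, after a case distinction on the traces whose
    first stuttering step goes to position 1.

    Strictness: on the singletons of the suffixes of (1^a 0^a)^omega, mumbling
    on 1 and on 0 compares the length of the first block of ones with that of
    the next block of zeros.  A stuttering head either sees no change at all and
    advances in lockstep, or only stops within a bounded distance of a block
    boundary, because LTL formulae count repetitions up to a threshold only.
    Hence the configurations of the latter heads, and the truth values of the
    subformulae, range over a finite set independent of [a].  For large [a] two
    of the first steps agree in both, and cutting the part between them off the
    first block goes unnoticed. *)

Set Implicit Arguments.
Unset Strict Implicit.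
Unset Printing Implicit Defensive.

(** * Function updates *)

Lemma upd_eq A (f : nat -> A) x a : upd f x a x = a.
Proof. by rewrite /upd eqxx. Qed.

Lemma upd_neq A (f : nat -> A) x a y : y <> x -> upd f x a y = f y.
Proof. by rewrite /upd; case: eqP. Qed.

Lemma upd_upd A (f : nat -> A) x a b : upd (upd f x a) x b = upd f x b.
Proof. by apply: funext => y; rewrite /upd; case: eqP. Qed.

Lemma updC A (f : nat -> A) x y a b : x <> y ->
  upd (upd f x a) y b = upd (upd f y b) x a.
Proof.
move=> xy; apply: funext => z; rewrite /upd.
by case: (z =P y) => [->|//]; case: eqP => // yx; case: xy.
Qed.

(** * Deterministic structures *)

Section Gsem.
Variables (AP : finType) (K : Type).
Implicit Types p : mform AP K.

Definition tests A := tform AP -> nat -> A -> Prop.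

(* Semantics over an abstract structure with a single deterministic
   successor: the labels of next operators are ignored, as they all denote
   the same successor function under unique mumbling or stuttering. *)
Fixpoint gsem A (nx : A -> A) (tst : tests A) (W : nat -> A -> Prop) p
    {struct p} : A -> Prop :=
  match p with
  | MTest d pi => tst d pi
  | MVar X => W X
  | MOr p1 p2 => fun v => gsem nx tst W p1 v \/ gsem nx tst W p2 v
  | MNot p1 => fun v => ~ gsem nx tst W p1 v
  | MNext _ p1 => fun v => gsem nx tst W p1 (nx v)
  | MMu X p1 => fun v => forall I : A -> Prop,
      (forall u, gsem nx tst (upd W X I) p1 u -> I u) -> I v
  end.

(** Negation flips the polarity, so monotonicity and antitonicity go through one induction. A binder
    that reuses [X] shadows it and overrides both updates. *)
Lemma gsem_polarity A (nx : A -> A) (tst : tests A) X (I J : A -> Prop) p :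
  (forall u, I u -> J u) -> forall b W, mocc_ok X b p -> forall u,
  if b then gsem nx tst (upd W X I) p u -> gsem nx tst (upd W X J) p u
  else gsem nx tst (upd W X J) p u -> gsem nx tst (upd W X I) p u.
Proof.
move=> IJ; elim: p => [d pi|Y|p1 IH1 p2 IH2|p1 IH1|k p1 IH1|Y p1 IH1] b W /=.
- by case: b.
- case: b => [_ u|YX u].
    by rewrite /upd; case: eqP => // _; apply: IJ.
  by case: (Y =P X) => [/YX//|ne]; rewrite !upd_neq.
- case=> ok1 ok2 u; move: (IH1 b W ok1 u) (IH2 b W ok2 u).
  by case: b {ok1 ok2} => h1 h2 [] h;
    [left; apply: h1|right; apply: h2|left; apply: h1|right; apply: h2].
- move=> ok u; move: (IH1 _ W ok u).
  by case: b {ok} => h n /h.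
- by move=> ok u; apply: IH1.
- case: (Y =P X) => [->|YX] ok u.
    have E L M : upd (upd W X L) X M = upd W X M by exact: upd_upd.
    by case: b {ok} => h L hL; apply: h => z; rewrite E => ?; apply: hL; rewrite E.
  have C L M : upd (upd W X L) Y M = upd (upd W Y M) X L.
    by apply: updC => /esym.
  case: ok => // ok; case: b ok => ok h L hL; apply: h => z; rewrite C => hz;
    apply: hL; rewrite C; [exact: (IH1 true) hz|exact: (IH1 false) hz].
Qed.

Lemma gsem_mono A (nx : A -> A) (tst : tests A) W X (I J : A -> Prop) p u :
  mocc_ok X true p -> (forall u, I u -> J u) ->
  gsem nx tst (upd W X I) p u -> gsem nx tst (upd W X J) p u.
Proof. by move=> ok IJ; exact: (gsem_polarity nx tst IJ (b := true)). Qed.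

(** Knaster-Tarski: as the body is monotone, the intersection of all pre-fixpoints is a fixpoint. *)
Lemma gsem_muE A (nx : A -> A) (tst : tests A) W X p v : mocc_ok X true p ->
  gsem nx tst W (MMu X p) v <->
  gsem nx tst (upd W X (gsem nx tst W (MMu X p))) p v.
Proof.
move=> ok; set L := gsem _ _ _ (MMu X p).
have sub u : gsem nx tst (upd W X L) p u -> L u.
  move=> h I hI; apply: (hI); move: h.
  by apply: (gsem_mono ok) => z; apply.
split; last exact: sub.
apply; move=> u; apply: (gsem_mono ok); exact: sub.
Qed.

(* Removing one point from the fixpoint does not change the unfolding at that
   point: a self-reference there can only lead to a circular derivation. *)
Lemma gsem_mu_remove A (nx : A -> A) (tst : tests A) W X p v :
  mocc_ok X true p ->
  gsem nx tst W (MMu X p) v <->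
  gsem nx tst (upd W X (fun u => u <> v /\ gsem nx tst W (MMu X p) u)) p v.
Proof.
move=> ok; set L := gsem _ _ _ (MMu X p); set L' := fun u => _.
split; last first.
  by rewrite /L gsem_muE //; apply: (gsem_mono ok) => u [].
(* [I] contains [v] only if the claim holds, so it suffices that [I] is a pre-fixpoint. If the claim
   holds, [I] lies within [L]; if it fails, [I] is just [L']. *)
move=> Lv; pose I u := L' u \/ (u = v /\ gsem nx tst (upd W X L') p v).
suff: I v by case=> [[]|[]].
apply: Lv => u hu.
have subL : gsem nx tst (upd W X L') p v -> forall z, I z -> L z.
  move=> h z [[]//|[-> _]]; rewrite /L gsem_muE //; move: h.
  by apply: (gsem_mono ok) => y [].
have [h|nh] := EM (gsem nx tst (upd W X L') p v).
  have [->|ne] := EM (u = v); first by right.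
  left; split=> //; rewrite /L gsem_muE //; move: hu.
  by apply: (gsem_mono ok); apply: subL.
have hu' : gsem nx tst (upd W X L') p u.
  by move: hu; apply: (gsem_mono ok) => z [|[]].
have [uv|ne] := EM (u = v); first by case: nh; rewrite -uv.
left; split=> //; rewrite /L gsem_muE //; move: hu'.
by apply: (gsem_mono ok) => z [].
Qed.

(** Fixpoints transfer because pre-fixpoints do, in both directions: those over [B] are pulled back
    along [h], and one over [A] yields the set of points of [B] whose preimages all lie in it. *)
Lemma gsem_hom A B (h : A -> B) nxA nxB (tA : tests A) (tB : tests B) p :
  (forall a, h (nxA a) = nxB (h a)) -> mwf p ->
  mall_tests (fun d pi => forall a, tA d pi a <-> tB d pi (h a)) p ->
  forall W a, gsem nxA tA (fun X a => W X (h a)) p a <-> gsem nxB tB W p (h a).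
Proof.
move=> hnx; elim: p => [d pi|Y|p1 IH1 p2 IH2|p1 IH1|k p1 IH1|X p1 IH1] /=.
- by move=> _ ht W a; apply: ht.
- by [].
- move=> [w1 w2] [t1 t2] W a.
  by move: (IH1 w1 t1 W a) (IH2 w2 t2 W a); tauto.
- by move=> w t W a; move: (IH1 w t W a); tauto.
- by move=> w t W a; rewrite -hnx; exact: IH1 w t W (nxA a).
- move=> [ok w] t W a.
  have updh (J : B -> Prop) : upd (fun X a => W X (h a)) X (fun a => J (h a)) =
      (fun Y a => upd W X J Y (h a)).
    by apply: funext => Y; rewrite /upd; case: eqP.
  split=> H.
    move=> J hJ; apply: (H (fun a => J (h a))) => u hu; apply: hJ.
    by rewrite -IH1 // -updh.
  move=> I hI; apply: (H (fun b => forall a, h a = b -> I a) _ a erefl).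
  move=> b hb a' ab; apply: hI; move: hb; rewrite -ab -IH1 // -updh.
  by apply: (gsem_mono ok) => u; apply.
Qed.

Lemma gsem_free A (nx : A -> A) (tst : tests A) p : forall W W',
  (forall X, mfree X p -> W X = W' X) -> gsem nx tst W p = gsem nx tst W' p.
Proof.
elim: p => [d pi|Y|p1 IH1 p2 IH2|p1 IH1|k p1 IH1|X p1 IH1] W W' /= E.
- by [].
- exact: E.
- by rewrite (IH1 W W') 1?(IH2 W W') // => X h; apply: E; [right|left].
- by rewrite (IH1 W W').
- by rewrite (IH1 W W').
- apply: funext => v; apply: eq_forall => I; congr (_ -> _).
  apply: eq_forall => u; rewrite (IH1 _ (upd W' X I)) // => Y fY.
  by rewrite /upd; case: (Y =P X) => // ne; apply: E; split=> // /esym.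
Qed.

Lemma msem_gsem (step : mstep AP K) Pi nx (Q : K -> Prop) p :
  (forall k v w, Q k -> step k Pi v w <-> w = nx v) -> mall_labels Q p ->
  forall W, msem step Pi W p =
    gsem nx (fun d pi v => tsem (Pi pi) emptyV d (v pi)) W p.
Proof.
move=> hs; elim: p => [d pi|Y|p1 IH1 p2 IH2|p1 IH1|k p1 IH1|X p1 IH1] //=.
- by move=> [l1 l2] W; rewrite IH1 // IH2.
- by move=> l W; rewrite IH1.
- move=> [Qk l] W; apply: funext => v; rewrite IH1 //; apply: propext; split.
    by move=> [w []] /(hs _ _ _ Qk) ->.
  by move=> h; exists (nx v); split=> //; apply/hs.
- move=> l W; apply: funext => v; apply: eq_forall => I; congr (_ -> _).
  by apply: eq_forall => u; rewrite IH1.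
Qed.

Lemma mall_tests_imp (P Q : tform AP -> nat -> Prop) p :
  (forall d pi, P d pi -> Q d pi) -> mall_tests P p -> mall_tests Q p.
Proof.
move=> PQ; elim: p => //= p1 IH1 p2 IH2 [t1 t2].
by split; [apply: IH1|apply: IH2].
Qed.

Lemma mall_tests_true (P : tform AP -> nat -> Prop) p :
  (forall d pi, P d pi) -> mall_tests P p.
Proof. by move=> h; elim: p => //= p1 ? p2 ?; split. Qed.

Lemma mall_tests_and (P Q : tform AP -> nat -> Prop) p :
  mall_tests P p -> mall_tests Q p -> mall_tests (fun d pi => P d pi /\ Q d pi) p.
Proof.
by elim: p => //= p1 IH1 p2 IH2 [t1 t2] [u1 u2]; split; [apply: IH1|apply: IH2].
Qed.

(** A formula has finitely many tests, so bounds chosen test by test merge into their maximum. *)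
Lemma mall_tests_bound (P : nat -> tform AP -> nat -> Prop) p :
  (forall m n d pi, m <= n -> P m d pi -> P n d pi) ->
  mall_tests (fun d pi => exists n, P n d pi) p -> exists n, mall_tests (P n) p.
Proof.
move=> Pmon; elim: p => //= p1 IH1 p2 IH2 [/IH1[m1 h1] /IH2[m2 h2]].
exists (maxn m1 m2); split.
  by apply: mall_tests_imp h1 => d pi; apply: Pmon; rewrite leq_maxl.
by apply: mall_tests_imp h2 => d pi; apply: Pmon; rewrite leq_maxr.
Qed.

End Gsem.

(** * Successors and LTL *)

Section Successors.

Lemma next_after_ex P i : exists j, next_after P i j.
Proof.
have [[j ij]|no] := EM (exists j, i < j /\ P j); last first.
  by exists i.+1; right; split=> // k ik Pk; apply: no; exists k.
have exP : exists j, (i < j) && `[< P j >].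
  by exists j; case: ij => -> /asboolP ->.
case: (ex_minnP exP) => m /andP[im /asboolP Pm] mmin.
exists m; left; split=> //; split=> // k /andP[ik km] Pk.
by move: (mmin k); rewrite ik leqNgt km /= => /(_ (asboolT Pk)).
Qed.

Definition next_pos P i := sval (cid (next_after_ex P i)).

Lemma next_posP P i : next_after P i (next_pos P i).
Proof. exact: svalP. Qed.

Lemma next_after_uniq P i j k : next_after P i j -> next_after P i k -> j = k.
Proof.
case=> [[ij [Pj nj]]|[no ->]] [[ik [Pk nk]]|[no' ->]] //.
- case: (ltngtP j k) => // h; first by case: (nk j); rewrite ?ij ?h.
  by case: (nj k); rewrite ?ik ?h.
- by case: (no' j).
- by case: (no k).
Qed.

Lemma next_posE P i j : next_after P i j -> next_pos P i = j.
Proof. exact: next_after_uniq (next_posP P i). Qed.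

Lemma next_pos_gt P i : i < next_pos P i.
Proof. by case: (next_posP P i) => [[]//|[_ ->]]. Qed.

Lemma next_pos_shift P i n : next_pos P (i + n) = next_pos (fun j => P (j + n)) i + n.
Proof.
apply: next_posE; case: (next_posP (fun j => P (j + n)) i) => [[ij [Pj nj]]|[no ->]].
  left; split; [lia|split=> // k kb].
  by have := nj (k - n); rewrite subnK; [apply; lia|lia].
right; split; last by lia.
by move=> k ik; have := no (k - n); rewrite subnK; [apply; lia|lia].
Qed.

End Successors.

Section LTL.
Variable AP : finType.
Implicit Types (tr : trace AP) (d : tform AP) (g : seq (tform AP)).

Lemma tOr_sem tr V d1 d2 i :
  tsem tr V (TOr d1 d2) i <-> tsem tr V d1 i \/ tsem tr V d2 i.
Proof. by []. Qed.

Lemma tAnd_sem tr V d1 d2 i :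
  tsem tr V (tAnd d1 d2) i <-> tsem tr V d1 i /\ tsem tr V d2 i.
Proof.
rewrite /=; split; last by tauto.
by move=> h; split; apply: contrapT; tauto.
Qed.

Lemma tNext_sem tr V d i : tsem tr V (TNext DirG d) i <-> tsem tr V d i.+1.
Proof. by rewrite /=; split=> [[j [->]]|h] //; exists i.+1. Qed.

(** The only variable an until introduces is bound by it, so nested untils may share a name without
    interference. *)
Lemma isLTL_closed tr d : isLTL d -> forall V V', tsem tr V d = tsem tr V' d.
Proof.
elim=> {d} [a|d _ IH|d1 d2 _ IH1 _ IH2|d _ IH|Y d1 d2 _ IH1 _ IH2] V V' /=.
- by [].
- by rewrite (IH V V').
- by rewrite (IH1 V V') (IH2 V V').
- by rewrite (IH V V').
- apply: funext => i; apply: eq_forall => I.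
  by rewrite (IH1 (upd V Y I) (upd V' Y I)) (IH2 (upd V Y I) (upd V' Y I)) !upd_eq.
Qed.

Lemma tUntil_sem tr V Y d1 d2 i : isLTL d1 -> isLTL d2 ->
  tsem tr V (tUntil Y d1 d2) i <->
  exists j, i <= j /\ tsem tr V d2 j /\ forall k, i <= k < j -> tsem tr V d1 k.
Proof.
move=> l1 l2.
have step I k : tsem tr (upd V Y I) (TOr d2 (tAnd d1 (TNext DirG (TVar AP Y)))) k <->
    tsem tr V d2 k \/ (tsem tr V d1 k /\ I k.+1).
  have -> : tsem tr V d2 = tsem tr (upd V Y I) d2 by apply: isLTL_closed.
  have -> : tsem tr V d1 = tsem tr (upd V Y I) d1 by apply: isLTL_closed.
  by rewrite tOr_sem tAnd_sem tNext_sem /= upd_eq.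
split.
  move=> U; apply: (U (fun i => exists j, i <= j /\ tsem tr V d2 j /\
    forall k, i <= k < j -> tsem tr V d1 k)) => k /step[d2k|[d1k [j [kj [d2j h]]]]].
    by exists k; split=> //; split=> // m; lia.
  exists j; split; [lia|split=> // m km].
  by have [<-//|ne] := eqVneq k m; apply: h; lia.
case=> j [ij [d2j h]] I hI.
(* Backward induction from the witness [j] down to [i]. *)
have H n : n <= j - i -> I (j - n).
  elim: n => [_|n IH lt].
    by rewrite subn0; apply: hI; apply/step; left.
  apply: hI; apply/step; right; split.
    by apply: h; lia.
  rewrite (_ : (j - n.+1).+1 = j - n); last by lia.
  by apply: IH; lia.
by have := H (j - i) (leqnn _); rewrite subKn.
Qed.

(** LTL looks only forward and never at the moves, so the labels of the suffix decide. *)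
Lemma isLTL_suffix tr tr' i i' d : isLTL d ->
  (forall k, (tr (k + i)).1 = (tr' (k + i')).1) ->
  forall k, tsem tr emptyV d (k + i) <-> tsem tr' emptyV d (k + i').
Proof.
move=> ld E; elim: ld => {d} [a|d _ IH|d1 d2 _ IH1 _ IH2|d _ IH|Y d1 d2 l1 IH1 l2 IH2] k.
- by rewrite /= E.
- by rewrite /= IH.
- by rewrite /= IH1 IH2.
- by rewrite !tNext_sem -!addSn.
- rewrite !tUntil_sem //; split=> -[j [kj [d2j h]]].
    exists (j - i + i'); split; [lia|split].
      by rewrite -IH2 subnK //; lia.
    move=> m mb; have := IH1 (m - i'); rewrite subnK; last by lia.
    by move=> <-; apply: h; lia.
  exists (j - i' + i); split; [lia|split].
    by rewrite IH2 subnK //; lia.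
  move=> m mb; have := IH1 (m - i); rewrite subnK; last by lia.
  by move=> ->; apply: h; lia.
Qed.

(* An LTL formula only counts up to a bounded number of repetitions. *)
Definition stable K d := forall tr p,
  (forall k, k <= K -> (tr (p + k)).1 = (tr p).1) ->
  tsem tr emptyV d p <-> tsem tr emptyV d p.+1.

Lemma stable_leq K L d : K <= L -> stable K d -> stable L d.
Proof. by move=> KL sK tr p E; apply: sK => k kK; apply: E; lia. Qed.

(** The threshold grows by one at a next operator. An until only needs those of its arguments: a
    witness beyond [p.+1] serves both positions once [d1] agrees at [p] and [p.+1], and a witness at
    [p] or [p.+1] can be moved to the other by the stability of [d2]. *)
Lemma isLTL_stable d : isLTL d -> exists K, stable K d.
Proof.
elim=> {d} [a|d _ [K IH]|d1 d2 _ [K1 IH1] _ [K2 IH2]|d _ [K IH]|Y d1 d2 l1 [K1 IH1] l2 [K2 IH2]].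
- by exists 1 => tr p /(_ 1 isT) /=; rewrite addn1 => ->.
- by exists K => tr p /IH /=; tauto.
- exists (maxn K1 K2) => tr p E /=.
  have h1 := stable_leq (leq_maxl K1 K2) IH1 E.
  by have := stable_leq (leq_maxr K1 K2) IH2 E; tauto.
- exists K.+1 => tr p E; rewrite !tNext_sem; apply: IH => k kK.
  by rewrite addSnnS E // -(E 1) // addn1.
- exists (maxn K1 K2) => tr p E.
  have h1 := stable_leq (leq_maxl K1 K2) IH1 E.
  have h2 := stable_leq (leq_maxr K1 K2) IH2 E.
  rewrite !tUntil_sem //; split=> -[j [pj [d2j h]]].
    have [Ej|ne] := eqVneq j p.
      by exists p.+1; split=> //; split; [apply/h2; rewrite -Ej|lia].
    by exists j; split; [lia|split=> // m mb; apply: h; lia].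
  have [Ej|ne] := eqVneq j p.+1.
    by exists p; split=> //; split; [apply/h2; rewrite -Ej|lia].
  exists j; split; [lia|split=> // m mb].
  have [->|nm] := eqVneq m p; last by apply: h; lia.
  by apply/h1; apply: h; lia.
Qed.

Definition differs tr g i j := exists d, List.In d g /\
  ~ (tsem tr emptyV d i <-> tsem tr emptyV d j).

Definition stut_succ tr g i := next_pos (differs tr g i) i.
Definition mum_succ tr d i := next_pos (tsem tr emptyV d) i.

Lemma differsN tr g i j : ~ differs tr g i j <->
  forall d, List.In d g -> (tsem tr emptyV d i <-> tsem tr emptyV d j).
Proof.
split; last by move=> h [d [/h]].
by move=> h d dg; apply: contrapT => n; apply: h; exists d.
Qed.

Lemma differsN_trans tr g i j k :
  ~ differs tr g i j -> ~ differs tr g j k -> ~ differs tr g i k.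
Proof. by rewrite !differsN => ij jk d dg; rewrite ij // jk. Qed.

Lemma differsN_sym tr g i j : ~ differs tr g i j -> ~ differs tr g j i.
Proof. by rewrite !differsN => ij d dg; rewrite ij. Qed.

Lemma differsN_refl tr g i : ~ differs tr g i i.
Proof. by rewrite differsN. Qed.

Lemma differsN_range tr g i j : i <= j ->
  (forall k, i <= k < j -> ~ differs tr g k k.+1) -> ~ differs tr g i j.
Proof.
elim: j => [|j IH] ij h.
  by rewrite (_ : i = 0); [apply: differsN_refl|lia].
have [->|ne] := eqVneq i j.+1; first exact: differsN_refl.
apply: (@differsN_trans _ _ _ j); last by apply: h; lia.
by apply: IH => [|k kb]; [lia|apply: h; lia].
Qed.

Lemma stut_step_succ (G G' : nat -> seq (tform AP)) Pi v w :
  (forall pi d, List.In d (G' pi) <-> List.In d (G pi)) ->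
  stut_step G' Pi v w <-> w = (fun pi => stut_succ (Pi pi) (G pi) (v pi)).
Proof.
move=> GG'; have E pi : differs (Pi pi) (G' pi) (v pi) = differs (Pi pi) (G pi) (v pi).
  by apply: funext => j; apply: eq_exists => d; rewrite (propext (GG' pi d)).
split=> [h|-> pi].
  by apply: funext => pi; apply/esym/next_posE; rewrite -E; apply: h.
by rewrite /stut_succ -E; apply: next_posP.
Qed.

Lemma mum_step_succ (D D' : nat -> tform AP) Pi v w :
  (forall pi, D' pi = D pi) ->
  mum_step D' Pi v w <-> w = (fun pi => mum_succ (Pi pi) (D pi) (v pi)).
Proof.
move=> DD'; split=> [h|-> pi].
  by apply: funext => pi; apply/esym/next_posE; rewrite -DD'; apply: h.
by rewrite DD'; apply: next_posP.
Qed.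

Definition head_tests (Pi : tassign AP) : tests AP (nat -> nat) :=
  fun d pi v => tsem (Pi pi) emptyV d (v pi).

Lemma msem_stut (G : nat -> seq (tform AP)) Pi W p :
  mall_labels (fun G' => forall pi d, List.In d (G' pi) <-> List.In d (G pi)) p ->
  msem (@stut_step AP) Pi W p =
  gsem (fun v pi => stut_succ (Pi pi) (G pi) (v pi)) (head_tests Pi) W p.
Proof. by move=> l; apply: (msem_gsem _ l) => G' v w; apply: stut_step_succ. Qed.

Lemma msem_mum (D : nat -> tform AP) Pi W p :
  mall_labels (fun D' => forall pi, D' pi = D pi) p ->
  msem (@mum_step AP) Pi W p =
  gsem (fun v pi => mum_succ (Pi pi) (D pi) (v pi)) (head_tests Pi) W p.
Proof. by move=> l; apply: (msem_gsem _ l) => D' v w; apply: mum_step_succ. Qed.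

End LTL.

(** * From stuttering to mumbling *)

Section StutteringToMumbling.
Variables (AP : finType) (x0 : AP).
Implicit Types (tr : trace AP) (d : tform AP) (g : seq (tform AP)).

(** Formulae have no constants, so truth is a tautology over an atomic proposition, which must
    therefore exist. *)
Definition tTrue : tform AP := TOr (TAp x0) (TNot (TAp x0)).

Lemma tTrue_sem tr V i : tsem tr V tTrue i.
Proof. exact: EM. Qed.

Lemma isLTL_true : isLTL tTrue.
Proof. by do ?constructor. Qed.

Lemma isLTL_and d1 d2 : isLTL d1 -> isLTL d2 -> isLTL (tAnd d1 d2).
Proof. by move=> l1 l2; do ?constructor. Qed.

Definition last_in_block g : tform AP :=
  foldr (fun d e => TOr (TOr (tAnd d (TNot (TNext DirG d)))
                             (tAnd (TNot d) (TNext DirG d))) e) (TNot tTrue) g.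

Lemma isLTL_last_in_block g :
  (forall d, List.In d g -> isLTL d) -> isLTL (last_in_block g).
Proof.
elim: g => [_|d g IH lg]; first exact/LTL_not/isLTL_true.
have ld : isLTL d by apply: lg; left.
apply: LTL_or; last by apply: IH => e eg; apply: lg; right.
by apply: LTL_or; apply: isLTL_and; do ?constructor.
Qed.

Lemma last_in_block_sem tr g i :
  tsem tr emptyV (last_in_block g) i <-> differs tr g i i.+1.
Proof.
elim: g => [|d g IH]; first by split=> [h|[d []]//]; case: h; apply: EM.
rewrite tOr_sem IH tOr_sem !tAnd_sem -[tsem _ _ (TNot d) i]/(~ tsem tr emptyV d i).
rewrite -[tsem _ _ (TNot (TNext DirG d)) i]/(~ tsem tr emptyV (TNext DirG d) i).
rewrite tNext_sem; split.
  case=> [h|[e [eg h]]]; last by exists e; split=> //; right.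
  by exists d; split; [left|tauto].
case=> e [[<-|eg] h]; last by right; exists e.
by left; case: (EM (tsem tr emptyV d i)) (EM (tsem tr emptyV d i.+1)) => hi [] hj; tauto.
Qed.

(** No position strictly between [i] and its mumbling successor is marked, so the base formulae keep
    their values from [i.+1] up to and including that successor. *)
Lemma stut_succ_block tr g i j : i <= j -> j < mum_succ tr (last_in_block g) i ->
  ~ differs tr g i.+1 j.+1.
Proof.
rewrite /mum_succ => ij jm; apply: differsN_range => [|k kb]; first by lia.
rewrite -last_in_block_sem.
case: (next_posP (tsem tr emptyV (last_in_block g)) i) => [[_ [_ h]]|[h _]]; apply: h; lia.
Qed.

(** The next marked position ends the block of [i.+1], so the first change comes right after it. If
    none is marked, both successors fall back to an increment, which preserves the offset of one. *)
Lemma stut_succS tr g i :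
  stut_succ tr g i.+1 = (mum_succ tr (last_in_block g) i).+1.
Proof.
apply: next_posE; have block := @stut_succ_block tr g i.
have gt : i < mum_succ tr (last_in_block g) i by apply: next_pos_gt.
case: (next_posP (tsem tr emptyV (last_in_block g)) i); rewrite -/(mum_succ _ _ _).
  move=> [_ [Pm _]]; left; split; first by lia.
  split; last by case=> // k kb; apply: block; lia.
  apply: contrapT => nd; move: Pm; rewrite last_in_block_sem.
  apply: (@differsN_trans _ _ _ _ i.+1); last exact: nd.
  apply: differsN_sym; case: (mum_succ _ _ _) gt block => // m im block.
  by apply: block; lia.
move=> [h Em]; right; split; last by rewrite Em.
move=> k ik; apply: differsN_range => [|m mb]; first by lia.
by rewrite -last_in_block_sem; apply: h; lia.
Qed.

(** At position 0 this says that the stuttering successor is 1: either the values change there, or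
    they never change and the default applies. *)
Definition leaves_at_once g : tform AP :=
  TOr (last_in_block g) (TNot (tUntil 0 tTrue (last_in_block g))).

Lemma isLTL_leaves_at_once g :
  (forall d, List.In d g -> isLTL d) -> isLTL (leaves_at_once g).
Proof.
move=> /isLTL_last_in_block lg; apply: LTL_or => //.
exact/LTL_not/LTL_until/lg/isLTL_true.
Qed.

Definition at_once tr g : bool := `[< tsem tr emptyV (leaves_at_once g) 0 >].

Lemma stut_succ0 tr g : (forall d, List.In d g -> isLTL d) ->
  stut_succ tr g 0 = (if at_once tr g then 0 else mum_succ tr (last_in_block g) 0).+1.
Proof.
move=> lg; apply: next_posE.
have U : tsem tr emptyV (tUntil 0 tTrue (last_in_block g)) 0 <->
    exists j, differs tr g j j.+1.
  rewrite (tUntil_sem _ _ _ _ isLTL_true (isLTL_last_in_block lg)).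
  split=> [[j [_ [/last_in_block_sem h _]]]|[j h]]; exists j => //.
  by rewrite last_in_block_sem; split=> //; split=> // k _; apply: tTrue_sem.
rewrite /at_once /leaves_at_once; case: asboolP; rewrite tOr_sem last_in_block_sem.
  move=> h; have [d01|nd] := EM (differs tr g 0 1).
    by left; split=> //; split=> // k; lia.
  right; split=> // k _; apply: differsN_range => // m _ dm.
  by case: h => // /=; apply; apply/U; exists m.
move=> h; have nd01 : ~ differs tr g 0 1 by tauto.
have [j dj] : exists j, differs tr g j j.+1.
  by apply/U; apply: contrapT; move: h => /=; tauto.
have block := @stut_succ_block tr g 0.
have gt : 0 < mum_succ tr (last_in_block g) 0 by apply: next_pos_gt.
case: (next_posP (tsem tr emptyV (last_in_block g)) 0); rewrite -/(mum_succ _ _ _).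
  move=> [_ [Pm _]]; left; split=> //.
  have block0 k : k < mum_succ tr (last_in_block g) 0 -> ~ differs tr g 0 k.+1.
    by move=> km; apply: (differsN_trans nd01); apply: block.
  split; last by case=> // k kb; apply: block0; lia.
  apply: contrapT => nd; move: Pm; rewrite last_in_block_sem.
  apply: (@differsN_trans _ _ _ _ 0); last exact: nd.
  apply: differsN_sym; case: (mum_succ _ _ _) gt block0 => // m im block0.
  exact: block0.
move=> [h' _]; case: j dj => // j; rewrite -last_in_block_sem => dj.
by case: (h' j.+1).
Qed.

Notation sform := (mform AP (nat -> seq (tform AP))).
Notation uform := (mform AP (nat -> tform AP)).

Section Translation.
Variables (D : nat -> tform AP) (S : nat -> bool).

(* A stuttering position [p > 0] is represented on the traces in [S] by the
   mumbling position [p - 1]; on the other traces, [p - 1] is only reached one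
   step later, so that tests have to look one step ahead. *)
Fixpoint trans (sg : nat -> uform) (p : sform) : uform :=
  match p with
  | MTest d pi => if S pi then MTest _ (TNext DirG d) pi
                  else MNext D (MTest _ (TNext DirG d) pi)
  | MVar X => sg X
  | MOr p1 p2 => MOr (trans sg p1) (trans sg p2)
  | MNot p1 => MNot (trans sg p1)
  | MNext _ p1 => MNext D (trans sg p1)
  | MMu X p1 => MMu X (trans (upd sg X (MVar _ _ X)) p1)
  end.

(* Translation at the initial position, which is never revisited: unguarded
   fixpoint variables are unfolded to false. *)
Fixpoint trans0 (sg : nat -> uform) (p : sform) : uform :=
  match p with
  | MTest d pi => MTest _ d pi
  | MVar X => MMu 0 (MVar _ _ 0)
  | MOr p1 p2 => MOr (trans0 sg p1) (trans0 sg p2)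
  | MNot p1 => MNot (trans0 sg p1)
  | MNext _ p1 => trans sg p1
  | MMu X p1 => trans0 (upd sg X (trans sg (MMu X p1))) p1
  end.

(** Excludes variable capture when [trans] passes under a binder. *)
Definition msubst_ok (sg : nat -> uform) :=
  forall Y, sg Y = MVar _ _ Y \/ forall X, ~ mfree X (sg Y).

Lemma msubst_ok_upd sg X : msubst_ok sg -> msubst_ok (upd sg X (MVar _ _ X)).
Proof.
by move=> ok Y; rewrite /upd; case: (Y =P X) => [->|_]; [left|apply: ok].
Qed.

Lemma trans_free p sg Z : msubst_ok sg -> mfree Z (trans sg p) ->
  exists2 Y, mfree Y p & mfree Z (sg Y).
Proof.
elim: p sg => [d pi|Y|p1 IH1 p2 IH2|p1 IH1|k p1 IH1|X p1 IH1] sg ok /=.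
- by case: ifP.
- by exists Y.
- case=> [/(IH1 _ ok)|/(IH2 _ ok)] [Y fY fZ]; exists Y => //; [by left|by right].
- exact: IH1.
- exact: IH1.
- case=> XZ /(IH1 _ (msubst_ok_upd X ok)) [Y fY]; rewrite /upd.
  by case: (Y =P X) => [_ /= /XZ//|YX fZ]; exists Y => //; split=> // /esym.
Qed.

Lemma not_mfree_mocc (K : Type) X (p : mform AP K) b : ~ mfree X p -> mocc_ok X b p.
Proof.
elim: p b => //= [p1 IH1 p2 IH2 b nf|p1 IH1 b nf|Y p1 IH1 b nf].
- by split; [apply: IH1|apply: IH2]; tauto.
- exact: IH1.
- by have [->|ne] := EM (Y = X); [left|right; apply: IH1; tauto].
Qed.

Lemma trans_mocc X p sg b : sg X = MVar _ _ X -> (forall Y, Y <> X -> ~ mfree X (sg Y)) ->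
  mocc_ok X b p -> mocc_ok X b (trans sg p).
Proof.
elim: p sg b => [d pi|Y|p1 IH1 p2 IH2|p1 IH1|k p1 IH1|Z p1 IH1] sg b sX nX /=.
- by case: ifP.
- by have [->|ne] := EM (Y = X); [rewrite sX|move=> _; apply/not_mfree_mocc/nX].
- by case=> o1 o2; split; [apply: IH1|apply: IH2].
- exact: IH1.
- exact: IH1.
- case=> [|o]; first by left.
  have [->|ne] := EM (Z = X); [by left|right; apply: IH1 => //].
    by rewrite upd_neq // => /esym.
  by move=> Y YX; rewrite /upd; case: eqP => [_ /= /ne|_]; last exact: nX.
Qed.

Lemma trans_mwf p sg : msubst_ok sg -> (forall Y, mwf (sg Y)) -> mwf p ->
  mwf (trans sg p).
Proof.
elim: p sg => [d pi|Y|p1 IH1 p2 IH2|p1 IH1|k p1 IH1|X p1 IH1] sg ok ws /=.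
- by case: ifP.
- by [].
- by case=> w1 w2; split; [apply: IH1|apply: IH2].
- exact: IH1.
- exact: IH1.
- case=> o w; split.
    apply: trans_mocc => //; first exact: upd_eq.
    move=> Y YX; rewrite upd_neq //; case: (ok Y) => [->|]; last exact.
    by move=> /= YX'.
  apply: IH1 => //; first exact: msubst_ok_upd.
  by move=> Y; rewrite /upd; case: eqP.
Qed.

Lemma trans_tests (P Q : tform AP -> nat -> Prop) p sg :
  (forall d pi, P d pi -> Q (TNext DirG d) pi) ->
  (forall Y, mall_tests Q (sg Y)) -> mall_tests P p -> mall_tests Q (trans sg p).
Proof.
move=> PQ; elim: p sg => [d pi|Y|p1 IH1 p2 IH2|p1 IH1|k p1 IH1|X p1 IH1] sg qs /=.
- by case: ifP => _ /=; apply: PQ.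
- by [].
- by case=> w1 w2; split; [apply: IH1|apply: IH2].
- exact: IH1.
- exact: IH1.
- by apply: IH1 => Y; rewrite /upd; case: eqP.
Qed.

Lemma trans_labels p sg (Q : (nat -> tform AP) -> Prop) : Q D ->
  (forall Y, mall_labels Q (sg Y)) -> mall_labels Q (trans sg p).
Proof.
move=> QD; elim: p sg => [d pi|Y|p1 IH1 p2 IH2|p1 IH1|k p1 IH1|X p1 IH1] sg qs //=.
- by case: ifP.
- by split; [apply: IH1|apply: IH2].
- exact: IH1.
- by split=> //; apply: IH1.
- by apply: IH1 => Y; rewrite /upd; case: eqP.
Qed.

Definition closed_subst (sg : nat -> uform) := forall Y X, ~ mfree X (sg Y).

Lemma closed_substW sg : closed_subst sg -> msubst_ok sg.
Proof. by move=> cs Y; right. Qed.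

Lemma trans_closed p sg : closed_subst sg -> forall Z, ~ mfree Z (trans sg p).
Proof. by move=> cs Z /(trans_free (closed_substW cs)) [Y _ /cs]. Qed.

Lemma closed_subst_upd sg X p : closed_subst sg -> closed_subst (upd sg X (trans sg p)).
Proof. by move=> cs Y; rewrite /upd; case: eqP => _; [apply: trans_closed|apply: cs]. Qed.

Lemma trans0_closed p sg : closed_subst sg -> forall Z, ~ mfree Z (trans0 sg p).
Proof.
elim: p sg => [d pi|Y|p1 IH1 p2 IH2|p1 IH1|k p1 IH1|X p1 IH1] sg cs Z.
- by [].
- by case.
- by case; [apply: IH1|apply: IH2].
- exact: IH1.
- exact: trans_closed.
- by apply: IH1; apply: (@closed_subst_upd _ _ (MMu X p1)).
Qed.

Lemma trans0_mwf p sg : closed_subst sg -> (forall Y, mwf (sg Y)) -> mwf p ->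
  mwf (trans0 sg p).
Proof.
elim: p sg => [d pi|Y|p1 IH1 p2 IH2|p1 IH1|k p1 IH1|X p1 IH1] sg cs ws //=.
- by case=> w1 w2; split; [apply: IH1|apply: IH2].
- exact: IH1.
- exact/trans_mwf/ws/closed_substW.
- case=> o w; apply: IH1 => //; first exact: (@closed_subst_upd _ _ (MMu X p1)).
  move=> Y; rewrite /upd; case: eqP => // _.
  exact: (@trans_mwf (MMu X p1)) (closed_substW cs) ws (conj o w).
Qed.

Lemma trans0_tests (P : tform AP -> nat -> Prop) p sg :
  (forall d pi, P d pi -> P (TNext DirG d) pi) ->
  (forall Y, mall_tests P (sg Y)) -> mall_tests P p -> mall_tests P (trans0 sg p).
Proof.
move=> PQ; elim: p sg => [d pi|Y|p1 IH1 p2 IH2|p1 IH1|k p1 IH1|X p1 IH1] sg qs //=.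
- by case=> w1 w2; split; [apply: IH1|apply: IH2].
- exact: IH1.
- exact: trans_tests.
- move=> t; apply: IH1 => // Y; rewrite /upd; case: eqP => // _.
  exact: (@trans_tests P P (MMu X p1)).
Qed.

Lemma trans0_labels p sg (Q : (nat -> tform AP) -> Prop) : Q D ->
  (forall Y, mall_labels Q (sg Y)) -> mall_labels Q (trans0 sg p).
Proof.
move=> QD; elim: p sg => [d pi|Y|p1 IH1 p2 IH2|p1 IH1|k p1 IH1|X p1 IH1] sg qs //=.
- by split; [apply: IH1|apply: IH2].
- exact: IH1.
- exact: trans_labels.
- apply: IH1 => // Y; rewrite /upd; case: eqP => // _.
  exact: (@trans_labels (MMu X p1)).
Qed.

End Translation.

Section TranslationSemantics.
Variables (G : nat -> seq (tform AP)) (Pi : tassign AP) (S : nat -> bool).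
Hypothesis G_LTL : forall pi d, List.In d (G pi) -> isLTL d.

Let D pi := last_in_block (G pi).
Let tst := head_tests Pi.
Let nxM (v : nat -> nat) pi := mum_succ (Pi pi) (D pi) (v pi).
Let nxS (v : nat -> nat) pi := stut_succ (Pi pi) (G pi) (v pi).
Let once pi := at_once (Pi pi) (G pi).
Let h (v : nat -> nat) pi := (if once pi then v pi else nxM v pi).+1.
Let zero : nat -> nat := fun _ => 0.

(** Makes [h] a homomorphism from mumbling to stuttering configurations; the optional extra mumbling
    step in [h] commutes with [nxM]. *)
Lemma represents_next v : h (nxM v) = nxS (h v).
Proof.
by apply: funext => pi; rewrite /nxS /h stut_succS /nxM; case: (once pi).
Qed.

Lemma represents_first : h zero = nxS zero.
Proof. by apply: funext => pi; rewrite /nxS stut_succ0 //; apply: G_LTL. Qed.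

(** Absorbing the translated tests into [tst'] and the substitution into the valuation turns the
    translation back into [p], evaluated over mumbling steps. The homomorphism [h] then carries it
    to stuttering steps. *)
Lemma trans_sem p sg V W : mwf p -> mall_tests (fun _ pi => S pi = once pi) p ->
  msubst_ok sg -> (forall Y v, gsem nxM tst V (sg Y) v <-> W Y (h v)) ->
  forall v, gsem nxM tst V (trans D S sg p) v <-> gsem nxS tst W p (h v).
Proof.
move=> wp tp sok sW v.
pose tst' : tests AP (nat -> nat) := fun d pi v =>
  tsem (Pi pi) emptyV d (if S pi then v pi else nxM v pi).+1.
have -> : gsem nxM tst V (trans D S sg p) =
    gsem nxM tst' (fun Y => gsem nxM tst V (sg Y)) p.
  move: sg V sok {wp tp sW}.
  elim: p => [d pi|Y|p1 IH1 p2 IH2|p1 IH1|k p1 IH1|X p1 IH1] sg V sok /=.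
  - apply: funext => u; rewrite /tst'; case: (S pi); apply: propext;
      exact: tNext_sem.
  - by [].
  - by rewrite IH1 // IH2.
  - by rewrite IH1.
  - by rewrite IH1.
  - apply: funext => u; apply: eq_forall => I; congr (_ -> _).
    apply: eq_forall => w; rewrite IH1; last exact: msubst_ok_upd.
    congr (gsem _ _ _ _ _ -> _); apply: funext => Y.
    have [->|YX] := EM (Y = X); first by rewrite !upd_eq /= upd_eq.
    rewrite !upd_neq //.
    case: (sok Y) => [->|nf]; first by rewrite /= upd_neq.
    by apply: gsem_free => Z /nf.
rewrite (_ : (fun Y => _) = (fun Y v => W Y (h v))); last first.
  by apply: funext => Y; apply: funext => u; apply/propext/sW.
apply: gsem_hom => //; first exact: represents_next.
apply: mall_tests_imp tp => d pi Spi u.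
by rewrite /tst' Spi /tst /head_tests /h; case: (once pi).
Qed.

Lemma trans0_sem p sg V W : mwf p -> mall_tests (fun _ pi => S pi = once pi) p ->
  closed_subst sg -> (forall V Y v, gsem nxM tst V (sg Y) v <-> W Y (h v)) ->
  (forall Y, ~ W Y zero) ->
  gsem nxM tst V (trans0 D S sg p) zero <-> gsem nxS tst W p zero.
Proof.
elim: p sg V W => [d pi|Y|p1 IH1 p2 IH2|p1 IH1|k p1 IH1|X p1 IH1] sg V W wp tp cs sW W0.
- by [].
- split=> [F|/W0//]; exfalso.
  by apply: (F (fun _ => False)) => u; rewrite /= upd_eq.
- by case: wp tp => [w1 w2] [t1 t2] /=; rewrite (IH1 _ _ W) // (IH2 _ _ W).
- by rewrite /= (IH1 _ _ W).
- by rewrite /= -represents_first; apply: trans_sem => //; apply: closed_substW.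
(* With the initial position removed from the fixpoint, [X] is false there, as [trans0] assumes. *)
- case: (wp) => o w1; rewrite gsem_mu_remove //=; apply: IH1 => //.
  + exact: (@closed_subst_upd _ _ _ _ (MMu X p1)).
  + move=> V' Y v; rewrite /upd; case: (Y =P X) => // _.
    rewrite (trans_sem (p := MMu X p1) wp tp (closed_substW cs) (sW V')).
    split=> [L|[]//]; split=> //.
    (* Every component of [h v] is a successor, so [h v] is never the initial position, and the
       removal is invisible at represented positions. *)
    by move/(congr1 (fun f => f 0)).
  + by move=> Y; rewrite /upd; case: eqP => // _ [].
Qed.

End TranslationSemantics.

(** * Case distinction on the traces and assembly of the formula *)

Definition mAnd (K : Type) (p q : mform AP K) := MNot (MOr (MNot p) (MNot q)).

Lemma mOr_sem K A nx (tst : tests AP A) W (p q : mform AP K) v :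
  gsem nx tst W (MOr p q) v <-> gsem nx tst W p v \/ gsem nx tst W q v.
Proof. by []. Qed.

Lemma mAnd_sem K A nx (tst : tests AP A) W (p q : mform AP K) v :
  gsem nx tst W (mAnd p q) v <-> gsem nx tst W p v /\ gsem nx tst W q v.
Proof.
rewrite /=; split; last by tauto.
by move=> H; split; apply: contrapT; tauto.
Qed.

Fixpoint mvars (K : Type) (p : mform AP K) : seq nat :=
  match p with
  | MTest _ pi => [:: pi]
  | MVar _ => [::]
  | MOr p1 p2 => mvars p1 ++ mvars p2
  | MNot p1 | MNext _ p1 | MMu _ p1 => mvars p1
  end.

Lemma mvars_mem K (p : mform AP K) : mall_tests (fun _ pi => pi \in mvars p) p.
Proof.
elim: p => //= [d pi|p1 IH1 p2 IH2]; first by rewrite inE.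
split; [apply: mall_tests_imp IH1|apply: mall_tests_imp IH2] => d pi;
  by rewrite mem_cat => ->; rewrite ?orbT.
Qed.

Lemma mvars_bound K (p : mform AP K) (B : nat -> Prop) :
  mall_tests (fun _ pi => B pi) p -> forall pi, pi \in mvars p -> B pi.
Proof.
elim: p => //= [d pi B0 pi'|p1 IH1 p2 IH2 [t1 t2] pi].
  by rewrite inE => /eqP ->.
by rewrite mem_cat => /orP[]; [apply: IH1|apply: IH2].
Qed.

Section CaseSplit.
Variables (G : nat -> seq (tform AP)) (f : (nat -> bool) -> uform).

(** The set [S] is fixed in the syntax of a translation, whereas [at_once] depends on the traces.
    Hence all cases are written out and the initial position selects the right one. *)
Fixpoint split_once (l : seq nat) (S : nat -> bool) : uform :=
  if l is pi :: l' then
    let t := MTest _ (leaves_at_once (G pi)) pi in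
    MOr (mAnd t (split_once l' (upd S pi true)))
        (mAnd (MNot t) (split_once l' (upd S pi false)))
  else f S.

(** Covers all syntactic side conditions at once: closedness, positivity, the LTL basis and the
    unique label. *)
Lemma split_once_ind (P : uform -> Prop) :
  (forall p q, P (MOr p q) <-> P p /\ P q) -> (forall p, P (MNot p) <-> P p) ->
  (forall S, P (f S)) -> forall l S,
  (forall pi, pi \in l -> P (MTest _ (leaves_at_once (G pi)) pi)) ->
  P (split_once l S).
Proof.
move=> Por Pnot Pf; elim=> [|pi l IH] S Pt //=.
have Ppi := Pt _ (mem_head pi l).
rewrite /mAnd; do !rewrite ?Por ?Pnot.
do !split=> //; apply: IH => pi' h; apply: Pt; rewrite inE h orbT //.
Qed.

Lemma split_once_sem nx Pi W l S :
  let v := fun _ => 0 in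
  let tst := head_tests Pi in
  exists S',
  (forall pi, pi \in l \/ S pi = at_once (Pi pi) (G pi) ->
     S' pi = at_once (Pi pi) (G pi)) /\
  (gsem nx tst W (split_once l S) v <-> gsem nx tst W (f S') v).
Proof.
move=> v tst; elim: l S => [|pi l IH] S.
  by exists S; split=> // pi [].
have [S' [hS' eS']] := IH (upd S pi (at_once (Pi pi) (G pi))).
exists S'; split.
  move=> pi'; rewrite inE => h; apply: hS'; rewrite /upd.
  by case: (pi' =P pi) h => [->|_] /= h; [right|].
rewrite -eS'; pose t : uform := MTest _ (leaves_at_once (G pi)) pi.
rewrite -[split_once (pi :: l) S]/(MOr (mAnd t (split_once l (upd S pi true)))
  (mAnd (MNot t) (split_once l (upd S pi false)))).
rewrite mOr_sem !mAnd_sem [gsem _ _ _ (MNot _)]/= [gsem _ _ _ t]/=.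
by rewrite /at_once /tst /v; case: asboolP; tauto.
Qed.

End CaseSplit.

Fixpoint hmap (K K' : Type) (q : mform AP K') (phi : hform AP K) : hform AP K' :=
  match phi with
  | HEx pi p => HEx pi (hmap q p)
  | HAll pi p => HAll pi (hmap q p)
  | HM _ => HM q
  end.

Lemma hmatrix_hmap K K' (q : mform AP K') (phi : hform AP K) : hmatrix (hmap q phi) = q.
Proof. by elim: phi. Qed.

Lemma htclosed_hmap K K' (q : mform AP K') (phi : hform AP K) B :
  (forall B : nat -> Prop, mall_tests (fun _ pi => B pi) (hmatrix phi) ->
     mall_tests (fun _ pi => B pi) q) ->
  htclosed B phi -> htclosed B (hmap q phi).
Proof.
by elim: phi B => /= [pi p IH|pi p IH|p] B h; [apply: IH|apply: IH|apply: h].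
Qed.

Lemma hsat_hmap K K' (q : mform AP K') (phi : hform AP K) stepK stepK' T :
  (forall Pi, msem stepK' Pi (fun _ _ => False) q (fun _ => 0) <->
     msem stepK Pi (fun _ _ => False) (hmatrix phi) (fun _ => 0)) ->
  forall Pi, hsat stepK' T Pi (hmap q phi) <-> hsat stepK T Pi phi.
Proof.
move=> h; elim: phi h => //= pi p IH h Pi.
  by split=> [[tr [Ttr]]|[tr [Ttr]]] s; exists tr; split=> //; move: s; apply IH.
by split=> s tr Ttr; move: (s tr Ttr); apply IH.
Qed.

Lemma mumbling_at_least_stuttering :
  at_least_as_expressive (@mum_step AP) (@MumLTLUnique AP)
    (@stut_step AP) (@StutLTLUnique AP).
Proof.
move=> phi [[clo [nfree wf]] [ltl [G [G_LTL lab]]]].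
set psi := hmatrix phi in nfree wf ltl lab.
pose D pi := last_in_block (G pi).
pose bot : nat -> uform := fun _ => MMu 0 (MVar _ _ 0).
pose f S := trans0 D S bot psi.
(* The initial choice [false] is overwritten at every trace variable tested in [psi]. *)
pose q := split_once G f (mvars psi) (fun _ => false).
have cbot : closed_subst bot by move=> Y X /= [].
have D_LTL pi : isLTL (D pi) by apply: isLTL_last_in_block; apply: G_LTL.
exists (hmap q phi); split.
  split; [split; [|split]|split]; rewrite ?hmatrix_hmap.
  - apply: htclosed_hmap clo => B Bpsi.
    apply: (@split_once_ind G f (mall_tests (fun _ pi => B pi))) => //.
      by move=> S; apply: trans0_tests.
    by move=> pi /(mvars_bound Bpsi).
  - move=> X; apply: (@split_once_ind G f (fun p => ~ mfree X p)) => //.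
    + by move=> p1 p2 /=; tauto.
    + by move=> S; apply: trans0_closed.
    + by move=> pi _ [].
  - by apply: (@split_once_ind G f (@mwf _ _)) => // S; apply: trans0_mwf.
  - apply: (@split_once_ind G f (mall_tests (fun d _ => isLTL d))) => //.
      by move=> S; apply: trans0_tests => // d _; apply: LTL_next.
    by move=> pi _; apply: isLTL_leaves_at_once; apply: G_LTL.
  - exists D; split=> //.
    apply: (@split_once_ind G f (mall_labels (fun D' => forall pi, D' pi = D pi))) => //.
    by move=> S; apply: trans0_labels.
move=> T; apply: hsat_hmap => Pi.
rewrite -/psi (msem_mum (D := D)); last first.
  apply: (@split_once_ind G f (mall_labels (fun D' => forall pi, D' pi = D pi))) => //.
  by move=> S; apply: trans0_labels.
rewrite (msem_stut _ _ lab).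
have [S [hS ->]] := @split_once_sem G f (fun v pi => mum_succ (Pi pi) (D pi) (v pi))
  Pi (fun _ _ => False) (mvars psi) (fun _ => false).
apply: trans0_sem => //.
  by apply: mall_tests_imp (mvars_mem psi) => d pi h; apply: hS; left.
  move=> V Y v; split=> // F.
  by apply: (F (fun _ => False)) => u; rewrite /= upd_eq.
by move=> _ [].
Qed.

End StutteringToMumbling.

(** * Pumping *)

Section Words.
Variables (AP : finType) (K : Type).
Implicit Types (p : mform AP K) (T : tests AP nat) (W : nat -> nat -> Prop).

(** The arguments of all next operators, with bound variables read as their fixpoints. Their truth
    values at a position act as the state of a backward automaton. *)
Fixpoint next_bodies T W p : seq (nat -> Prop) :=
  match p with
  | MTest _ _ | MVar _ => [::]
  | MOr p1 p2 => next_bodies T W p1 ++ next_bodies T W p2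
  | MNot p1 => next_bodies T W p1
  | MNext _ p1 => gsem succn T W p1 :: next_bodies T W p1
  | MMu X p1 => next_bodies T (upd W X (gsem succn T W (MMu X p1))) p1
  end.

Definition at_pos (i : nat) (l : seq (nat -> Prop)) : seq Prop := [seq P i | P <- l].

Lemma size_next_bodies p T T' W W' :
  size (next_bodies T W p) = size (next_bodies T' W' p).
Proof.
elim: p W W' => //= [p1 IH1 p2 IH2|k p1 IH1] W W'.
  by rewrite !size_cat (IH1 _ W') (IH2 _ W').
by rewrite (IH1 _ W').
Qed.

Lemma next_bodies_shift p T T' W n i : mwf p ->
  mall_tests (fun d pi => forall i, T' d pi i <-> T d pi (i + n)) p ->
  at_pos (i + n) (next_bodies T W p) =
  at_pos i (next_bodies T' (fun X a => W X (a + n)) p).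
Proof.
elim: p W => //= [p1 IH1 p2 IH2|k p1 IH1|X p1 IH1] W.
- by move=> [w1 w2] [t1 t2]; rewrite /at_pos !map_cat; congr (_ ++ _); [apply: IH1|apply: IH2].
- move=> w t; congr (_ :: _); last exact: IH1.
  by apply/esym/propext; apply: (@gsem_hom _ _ _ _ (fun i => i + n)).
- move=> [o w] t; rewrite IH1 //; congr (at_pos _ (next_bodies _ _ _)).
  apply: funext => Y; rewrite /upd; case: (Y =P X) => // _.
  apply: funext => a; apply/esym/propext.
  by apply: (@gsem_hom _ _ _ _ (fun i => i + n) succn succn T' T (MMu X p1)).
Qed.

Lemma cat_inj A (s1 s2 t1 t2 : seq A) : size s1 = size s2 ->
  s1 ++ t1 = s2 ++ t2 -> s1 = s2 /\ t1 = t2.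
Proof.
elim: s1 s2 => [|x s1 IH] [|y s2] //= [/IH h] [-> /h [-> ->]]; by [].
Qed.

(** One backward transition: tests at [i] and the state at [i.+1] determine truth and state at [i].
    At a fixpoint, [gsem_mu_remove] breaks the self-reference at [i] itself. *)
Lemma gsem_backward p T T' W W' i i' : mwf p ->
  mall_tests (fun d pi => T d pi i <-> T' d pi i') p ->
  (forall X, W X i <-> W' X i') ->
  at_pos i.+1 (next_bodies T W p) = at_pos i'.+1 (next_bodies T' W' p) ->
  (gsem succn T W p i <-> gsem succn T' W' p i') /\
  at_pos i (next_bodies T W p) = at_pos i' (next_bodies T' W' p).
Proof.
elim: p W W' => [d pi|Y|p1 IH1 p2 IH2|p1 IH1|k p1 IH1|X p1 IH1] W W' /=.
- by [].
- by [].
- move=> [w1 w2] [t1 t2] E; rewrite /at_pos !map_cat => /cat_inj[].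
    by rewrite !size_map; apply: size_next_bodies.
  move=> /(IH1 _ _ w1 t1 E) [e1 a1] /(IH2 _ _ w2 t2 E) [e2 a2].
  by split; [tauto|congr (_ ++ _)].
- by move=> w t E /(IH1 _ _ w t E) [e a]; split=> //; tauto.
- move=> w t E [/= Eh /(IH1 _ _ w t E) [e a]]; rewrite Eh; split=> //.
  by congr (_ :: _) => //; apply: propext.
- move=> [o w] t E A.
  (* Steps only go forward, so removing [j] from a valuation is invisible from [j.+1] on. *)
  have removed S V j : at_pos j.+1 (next_bodies S
        (upd V X (fun u => u <> j /\ gsem succn S V (MMu X p1) u)) p1) =
      at_pos j.+1 (next_bodies S (upd V X (gsem succn S V (MMu X p1))) p1).
    rewrite -[j.+1]add0n.
    rewrite !(@next_bodies_shift _ _ (fun d pi a => S d pi (a + j.+1))) //;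
      try exact: mall_tests_true.
    congr (at_pos _ (next_bodies _ _ _)); apply: funext => Y; apply: funext => a.
    rewrite /upd; case: eqP => // _; apply: propext; split=> [[]//|h].
    by split=> //; lia.
  have Lii' : gsem succn T W (MMu X p1) i <-> gsem succn T' W' (MMu X p1) i'.
    rewrite !gsem_mu_remove //; apply IH1 => //.
      by move=> Y; rewrite /upd; case: eqP => // _; split=> -[].
    by rewrite !removed.
  split=> //; apply IH1 => // Y.
  by rewrite /upd; case: eqP.
Qed.

(** [T2] follows [T1] up to [m] and then continues as [T1] does from [n]. Equal states at [m] and
    [n] give [T1] and [T2] the same state at [m], and backward transitions carry this to 0. *)
Lemma gsem_pump p T1 T2 W m n : mwf p -> (forall X i, ~ W X i) -> 0 < m ->
  (forall i, i < m -> mall_tests (fun d pi => T1 d pi i <-> T2 d pi i) p) ->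
  mall_tests (fun d pi => forall i, T1 d pi (i + n) <-> T2 d pi (i + m)) p ->
  at_pos m (next_bodies T1 W p) = at_pos n (next_bodies T1 W p) ->
  gsem succn T1 W p 0 <-> gsem succn T2 W p 0.
Proof.
move=> w W0 m0 before after Emn.
have W_F : W = (fun _ _ => False).
  apply: funext => X; apply: funext => i; apply: propext; split=> // /W0 //.
have Em : at_pos m (next_bodies T1 W p) = at_pos m (next_bodies T2 W p).
  rewrite Emn -[n]add0n -[m]add0n W_F.
  rewrite (@next_bodies_shift _ T1 (fun d pi i => T1 d pi (i + n))) //; last exact: mall_tests_true.
  rewrite (@next_bodies_shift _ T2 (fun d pi i => T1 d pi (i + n))) //.
have Wiff X i : W X i <-> W X i by [].
have down k : k < m -> at_pos (m - k) (next_bodies T1 W p) = at_pos (m - k) (next_bodies T2 W p).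
  elim: k => [|k IH] km; first by rewrite subn0.
  apply gsem_backward => //; first by apply: before; lia.
  by rewrite (_ : (m - k.+1).+1 = m - k); [apply: IH; lia|lia].
apply gsem_backward => //; first exact: before.
by have := down m.-1; rewrite (_ : m - m.-1 = 1); [apply; lia|lia].
Qed.

End Words.

(** * Separation *)

Section Separation.
Variables (AP : finType) (x0 : AP).
Implicit Types (tr : trace AP) (d : tform AP) (g : seq (tform AP)).

(** * Suffixes and the orbit of a single head *)

Definition shift tr n : trace AP := fun i => tr (i + n).

Lemma tsem_shift tr n d i : isLTL d ->
  tsem (shift tr n) emptyV d i <-> tsem tr emptyV d (i + n).
Proof.
move=> ld; rewrite -{1}[i]addn0; apply: (isLTL_suffix ld) => k.
by rewrite /shift addn0.
Qed.

Definition LTL_seq g := forall d, List.In d g -> isLTL d.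

Lemma differs_shift tr n g i j : LTL_seq g ->
  differs (shift tr n) g i j <-> differs tr g (i + n) (j + n).
Proof.
by move=> lg; split=> -[d [dg h]]; exists d; split=> //; move: h;
  rewrite !tsem_shift //; apply: lg.
Qed.

Lemma stut_succ_shift tr g n i : LTL_seq g ->
  stut_succ tr g (i + n) = stut_succ (shift tr n) g i + n.
Proof.
move=> lg; rewrite /stut_succ next_pos_shift; congr (next_pos _ _ + _).
by apply: funext => j; apply/esym/propext/differs_shift.
Qed.

Definition orbit tr g p i := iter i (stut_succ tr g) p.

Lemma orbit_shift tr g p i : LTL_seq g -> orbit tr g p i = orbit (shift tr p) g 0 i + p.
Proof.
by move=> lg; elim: i => //= i IH; rewrite /orbit /= -!/(orbit _ _ _ _) IH stut_succ_shift.
Qed.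

Lemma tsem_orbit_shift tr g d p i : LTL_seq g -> isLTL d ->
  tsem tr emptyV d (orbit tr g p i) <->
  tsem (shift tr p) emptyV d (orbit (shift tr p) g 0 i).
Proof. by move=> lg ld; rewrite tsem_shift // -orbit_shift. Qed.

(** * Square waves *)

Definition wave a : trace AP := fun i => (if i %% (2 * a) < a then [set x0] else set0, MInt).

Lemma wave_mod a i j : i = j %[mod 2 * a] -> shift (wave a) i = shift (wave a) j.
Proof.
move=> ij; apply: funext => k; rewrite /shift /wave.
by rewrite -(modnDmr k i) ij modnDmr.
Qed.

Lemma tsem_wave_mod a d i j : isLTL d -> i = j %[mod 2 * a] ->
  tsem (wave a) emptyV d i <-> tsem (wave a) emptyV d j.
Proof.
move=> ld /wave_mod E.
by rewrite -[i]add0n -[j]add0n -!tsem_shift // E.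
Qed.

Lemma wave_label a p : (wave a p).1 = if p %% (2 * a) < a then [set x0] else set0.
Proof. by []. Qed.

(** Away from the last [K] positions of a block, the next [K] labels repeat the current one and
    stability forbids a change. *)
Lemma wave_change a K d p : stable K d -> K < a ->
  ~ (tsem (wave a) emptyV d p <-> tsem (wave a) emptyV d p.+1) ->
  p %% (2 * a) \in iota (a - K) K ++ iota (2 * a - K) K.
Proof.
move=> sK Ka h; rewrite mem_cat !mem_iota; apply: contrapT => out; apply: h.
have lt : p %% (2 * a) < 2 * a by rewrite ltn_mod; lia.
apply: sK => k kK; rewrite !wave_label.
have -> : (p + k) %% (2 * a) = p %% (2 * a) + k.
  by rewrite -modnDml modn_small //; lia.
by rewrite (_ : (p %% (2 * a) + k < a) = (p %% (2 * a) < a)) //; lia.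
Qed.

Lemma wave_start a K d p : stable K d -> p + K < a ->
  tsem (wave a) emptyV d 0 <-> tsem (wave a) emptyV d p.
Proof.
move=> sK; elim: p => // p IH pK; rewrite IH; last by lia.
apply: sK => k kK; rewrite !wave_label !modn_small ?ifT //; lia.
Qed.

Definition moving a g := exists p q, differs (wave a) g p q.

Lemma still_succ a g i : ~ moving a g -> stut_succ (wave a) g i = i.+1.
Proof. by move=> nm; apply: next_posE; right; split=> // k _ h; apply: nm; exists i, k. Qed.

Lemma still_orbit a g p i : ~ moving a g -> orbit (wave a) g p i = i + p.
Proof. by move=> nm; elim: i => //= i IH; rewrite /orbit /= -/(orbit _ _ _ _) still_succ // IH. Qed.

(** By periodicity, every position [r] has a congruent one beyond [i]. If nothing beyond [i]
    differed from [i], nothing at all would, so the default successor never occurs. *)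
Lemma moving_succ a g i : 0 < a -> LTL_seq g -> moving a g ->
  let j := stut_succ (wave a) g i in
  [/\ i < j, differs (wave a) g i j & forall k, i < k < j -> ~ differs (wave a) g i k].
Proof.
move=> a0 lg [p [q pq]] j; rewrite /j.
case: (next_posP (differs (wave a) g i) i) => [[h1 [h2 h3]]|[no _]]; first by split.
have nd r : ~ differs (wave a) g i r.
  apply: (@differsN_trans _ _ _ _ (r + i.+1 * (2 * a))).
    by apply: no; nia.
  rewrite differsN => e eg; apply: tsem_wave_mod; first exact: lg.
  by rewrite addnC modnMDl.
case: (@differsN_trans _ (wave a) g p i q) => //.
exact: differsN_sym.
Qed.

Lemma moving_change a g i : 0 < a -> LTL_seq g -> moving a g ->
  let j := stut_succ (wave a) g i in differs (wave a) g j.-1 j.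
Proof.
move=> a0 lg mg; have [ij dij h] := moving_succ i a0 lg mg; move=> j.
have [Ej|ne] := eqVneq j.-1 i; first by rewrite Ej.
apply: contrapT => nd; move: dij; apply: differsN_trans nd.
by apply: h; rewrite -/j; lia.
Qed.

(** Lets heads started at different points early in a block meet after their first step. *)
Lemma moving_start a g p : 0 < a -> LTL_seq g -> moving a g ->
  (forall k, k <= p -> ~ differs (wave a) g 0 k) ->
  stut_succ (wave a) g p = stut_succ (wave a) g 0.
Proof.
move=> a0 lg mg nd; apply: next_posE; have [j0 dj h] := moving_succ 0 a0 lg mg.
set j := stut_succ _ _ 0 in j0 dj h *.
have pj : p < j by rewrite ltnNge; apply/negP => /nd.
left; split=> //; split.
  by apply: contrapT => n; move: dj; apply: differsN_trans n; apply: nd.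
move=> k kb; apply: (differsN_trans (differsN_sym (nd p (leqnn p)))).
by apply: h; lia.
Qed.

Lemma pigeonhole (F : finType) (f : 'I_#|F|.+1 -> F) : exists x y : 'I__, x < y /\ f x = f y.
Proof.
apply: contrapT => no; suff /leq_card : injective f by rewrite card_ord ltnn.
move=> x y fxy; apply: val_inj => /=.
by case: (ltngtP x y) => // h; case: no; [exists x, y|exists y, x].
Qed.

Lemma stable_seq g : LTL_seq g -> exists K, forall d, List.In d g -> stable K d.
Proof.
elim: g => [|d g IH] lg; first by exists 0.
have [K1 h1] := isLTL_stable (lg d (or_introl erefl)).
have [K2 h2] := IH (fun e eg => lg e (or_intror eg)).
exists (maxn K1 K2) => e [<-|/h2 h]; first exact: stable_leq (leq_maxl _ _) h1.
exact: stable_leq (leq_maxr _ _) h.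
Qed.

Lemma stable_family (G : nat -> seq (tform AP)) n : (forall pi, LTL_seq (G pi)) ->
  exists K, forall pi d, pi < n -> List.In d (G pi) -> stable K d.
Proof.
move=> lG; elim: n => [|n [K1 h1]]; first by exists 0.
have [K2 h2] := stable_seq (lG n).
exists (maxn K1 K2) => pi d; rewrite ltnS leq_eqVlt => /orP[/eqP ->|lt] dg.
  exact: stable_leq (leq_maxr _ _) (h2 _ dg).
exact: stable_leq (leq_maxl _ _) (h1 _ _ lt dg).
Qed.

Lemma hsat_singleton (K : Type) (step : mstep AP K) tr (phi : hform AP K) Pi B :
  htclosed B phi -> (forall pi, B pi -> Pi pi = tr) -> exists Pi',
  mall_tests (fun _ pi => Pi' pi = tr) (hmatrix phi) /\
  (hsat step (fun t => t = tr) Pi phi <->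
   msem step Pi' (fun _ _ => False) (hmatrix phi) (fun _ => 0)).
Proof.
have updB (P : tassign AP) pi (C : nat -> Prop) : (forall x, C x -> P x = tr) ->
    forall x, x = pi \/ C x -> upd P pi tr x = tr.
  by move=> h x hx; rewrite /upd; case: (x =P pi) => // ne; apply: h; tauto.
elim: phi Pi B => /= [pi p IH|pi p IH|p] Pi B clo hB.
- have [Pi' [h1 h2]] := IH _ _ clo (updB _ _ _ hB); exists Pi'; split=> //.
  by rewrite -h2; split=> [[t [->]]|h] //; exists tr.
- have [Pi' [h1 h2]] := IH _ _ clo (updB _ _ _ hB); exists Pi'; split=> //.
  by rewrite -h2; split=> [|h t ->] //; apply.
- by exists Pi; split=> //; apply: mall_tests_imp clo => d pi; apply: hB.
Qed.

Definition orbit_tests (G : nat -> seq (tform AP)) tr : tests AP nat :=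
  fun d pi i => tsem tr emptyV d (orbit tr (G pi) 0 i).

(** On a singleton all quantifiers pick the same trace, and the configuration after [i] steps is a
    function of [i]: counting steps is a homomorphism from [succn]. *)
Lemma models_stut_singleton (G : nat -> seq (tform AP)) tr phi :
  htclosed (fun _ => False) phi -> mwf (hmatrix phi) ->
  mall_labels (fun G' => forall pi d, List.In d (G' pi) <-> List.In d (G pi))
    (hmatrix phi) ->
  models (@stut_step AP) (fun t => t = tr) phi <->
  gsem succn (orbit_tests G tr) (fun _ _ => False) (hmatrix phi) 0.
Proof.
move=> clo wf lab; rewrite /models.
have [|Pi [hPi ->]] := @hsat_singleton _ (@stut_step AP) tr phi (fun _ => default_trace AP) _ clo.
  by [].
rewrite (msem_stut _ _ lab); apply: iff_sym.
pose nx (v : nat -> nat) pi := stut_succ (Pi pi) (G pi) (v pi).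
apply: (@gsem_hom _ _ _ _ (fun i => iter i nx (fun _ => 0)) succn nx) => //.
apply: mall_tests_imp hPi => d pi hpi i; rewrite /orbit_tests /head_tests hpi.
suff -> : iter i nx (fun _ => 0) pi = orbit tr (G pi) 0 i by [].
by elim: i => //= i IH; rewrite /orbit /= -/(orbit _ _ _ _) -IH /nx hpi.
Qed.

Lemma stuttering_blind (phi : hform AP (nat -> seq (tform AP))) : StutLTLUnique phi ->
  exists a n, [/\ 0 < n, n + 2 <= a &
    models (@stut_step AP) (fun t => t = wave a) phi <->
    models (@stut_step AP) (fun t => t = shift (wave a) n) phi].
Proof.
move=> [[clo [_ wf]] [ltl [G [lG lab]]]]; set psi := hmatrix phi in wf ltl lab.
have [k hk] : exists k, mall_tests (fun _ pi => pi < k) psi.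
  apply: mall_tests_bound (fun n _ pi => pi < n) _ _ _; first by move=> *; lia.
  by apply: mall_tests_true => d pi; exists pi.+1.
have [K1 hK1] : exists K, mall_tests (fun d _ => stable K d) psi.
  apply: (@mall_tests_bound _ _ (fun K d _ => stable K d)).
    by move=> m n d _; apply: stable_leq.
  by apply: mall_tests_imp ltl => d _; apply: isLTL_stable.
have [K2 hK2] := stable_family k lG.
pose K := maxn K1 K2; pose W0 : nat -> nat -> Prop := fun _ _ => False.
(* Only the length matters here, and dummy tests fix it before [a] is chosen. *)
pose N := size (next_bodies (fun _ _ _ => False) W0 psi).
(* A state consists of a residue code per head, where [2 * K] would stand for a residue outside [R],
   and the truth values of the next bodies. Its type is independent of [a], so [a] can exceed its
   size by enough to keep the first [n] positions more than [K] before the end of the first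
   block. *)
pose F : finType := ({ffun 'I_k -> 'I_(2 * K).+1} * {ffun 'I_N -> bool})%type.
pose a := #|F| + K + 3; pose w := wave a; exists a.
have a0 : 0 < a by rewrite /a; lia.
have sK pi d : pi < k -> List.In d (G pi) -> stable K d.
  by move=> pk dg; apply: stable_leq (leq_maxr _ _) (hK2 _ _ pk dg).
pose T1 := orbit_tests G w.
pose R := iota (a - K) K ++ iota (2 * a - K) K.
(* [wave_change] locates the position just before a stop, hence the predecessor. *)
pose code pi i := index ((orbit w (G pi) 0 i).-1 %% (2 * a)) R.
pose bodies i := at_pos i (next_bodies T1 W0 psi).
(* Steps are counted from 1, because the starting position is not near a block boundary. *)
have [x [y [xy [Ecode Ebodies]]]] := @pigeonhole F (fun x =>
  ([ffun pi : 'I_k => inord (code pi x.+1)],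
   [ffun j : 'I_N => `[< nth False (bodies x.+1) j >]])).
have := ltn_ord y; set m := x.+1; set n := y.+1 => nF; exists (n - m).
split; [lia|rewrite /a; lia|].
have start d : stable K d -> forall p, p <= n ->
    tsem w emptyV d 0 <-> tsem w emptyV d p.
  by move=> sd p pn; apply: (wave_start sd); rewrite /a; lia.
have still pi i p : ~ moving a (G pi) -> orbit w (G pi) p i = i + p.
  exact: still_orbit.
(* Positions 0 to [n - m] look alike to a moving head, so the cut is forgotten after one step. *)
have first_hop pi i : pi < k -> moving a (G pi) ->
    orbit w (G pi) (n - m) i.+1 = orbit w (G pi) 0 i.+1.
  move=> pk mv; rewrite /orbit !iterSr moving_start //; first exact: lG.
  move=> q qn; rewrite differsN => d dg; apply: start; [exact: sK dg|lia].
have same_residue pi : pi < k -> moving a (G pi) ->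
    orbit w (G pi) 0 m = orbit w (G pi) 0 n %[mod 2 * a].
  move=> pk mv.
  have inR i : (orbit w (G pi) 0 i.+1).-1 %% (2 * a) \in R /\ 0 < orbit w (G pi) 0 i.+1.
    rewrite {1 2}/orbit /= -/(orbit _ _ _ _); set p := orbit w (G pi) 0 i.
    have [] := moving_change p a0 (lG pi) mv => d [dg h].
    have [lt _ _] := moving_succ p a0 (lG pi) mv; split; last by rewrite /w; lia.
    apply: (wave_change (sK pi d pk dg)); first by rewrite /a; lia.
    by rewrite prednK //; rewrite /w; lia.
  have /ffunP/(_ (Ordinal pk)) := Ecode; rewrite !ffunE => /(congr1 (@nat_of_ord _)).
  have [in1 gt1] := inR x; have [in2 gt2] := inR y.
  have szR : size R = 2 * K by rewrite size_cat !size_iota; lia.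
  have small q i : code q i < (2 * K).+1 by rewrite ltnS -szR index_size.
  rewrite !inordK // => /(congr1 (nth 0 R)).
  rewrite !nth_index // => /(congr1 (addn^~ 1)) /(congr1 (modn^~ (2 * a))).
  by rewrite !modnDml !addn1 !prednK.
rewrite !(models_stut_singleton _ clo wf lab) -/psi -/T1.
have T2E d pi i : isLTL d -> orbit_tests G (shift w (n - m)) d pi i <->
    tsem w emptyV d (orbit w (G pi) (n - m) i).
  by move=> ld; rewrite tsem_orbit_shift //; apply: lG.
have T := mall_tests_and (mall_tests_and hk hK1) ltl.
apply: (@gsem_pump _ _ psi T1 _ _ m n) => //.
- by move=> X i [].
(* Before step [m], moving heads differ only at step 0, and there, as for still heads, both
   positions satisfy the same tests as position 0. *)
- move=> i im; apply: mall_tests_imp T => d pi [[pk sd1] ld]; rewrite T2E //.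
  have sd : stable K d by apply: stable_leq (leq_maxl _ _) sd1.
  have [mv|nm] := EM (moving a (G pi)).
    case: i im => [_|i im]; last by rewrite first_hop.
    by rewrite /T1 /orbit_tests /orbit /= -start //; lia.
  by rewrite /T1 /orbit_tests !still // -!start //; lia.
(* From step [m] on, a still head in the cut trace is exactly [n - m] positions ahead. A moving head
   is at its old stop [m], congruent to its stop [n]. *)
- apply: mall_tests_imp T => d pi [[pk _] ld] i; rewrite T2E //.
  have [mv|nm] := EM (moving a (G pi)); last first.
    rewrite /T1 /orbit_tests !still // (_ : i + m + (n - m) = i + n + 0) //.
    by lia.
  rewrite /m addnS first_hop // -addnS -/m /T1 /orbit_tests.
  have E := wave_mod (same_residue pi pk mv).
  rewrite /orbit !iterD -/(orbit w (G pi) 0 m) -/(orbit w (G pi) 0 n).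
  have h p := tsem_orbit_shift w p i (lG pi) ld.
  by rewrite -!/(orbit _ _ _ _) !{}h E.
- have sz i : size (bodies i) = N by rewrite size_map; apply: size_next_bodies.
  apply: (@eq_from_nth _ False) => [|j]; rewrite -!/(bodies _) !sz // => jN.
  have /ffunP/(_ (Ordinal jN)) := Ebodies; rewrite !ffunE /= => Eb.
  by rewrite -[LHS]asboolE -[RHS]asboolE Eb.
Qed.

(** * A mumbling formula comparing block lengths *)

Definition lengths_labels (pi : nat) : tform AP :=
  if pi is 0 then TAp x0 else TNot (TAp x0).

(* One head runs through the initial block of [x0] while the other one runs
   through the following block without [x0]. When the former is about to
   leave its block, the latter must be two positions before the end of its own,
   as its first step already took it to the beginning of the second block. *)
Definition same_lengths_body : mform AP (nat -> tform AP) :=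
  let A := MTest _ (TNext DirG (TNot (TAp x0))) 0 in
  let B := MTest _ (TNext DirG (TNext DirG (TAp x0))) 1 in
  MMu 0 (MOr (mAnd A B) (mAnd (MNot A) (MNext lengths_labels (MVar _ _ 0)))).

Definition same_lengths : hform AP (nat -> tform AP) := HEx 0 (HEx 1 (HM same_lengths_body)).

Lemma same_lengths_unique : MumLTLUnique same_lengths.
Proof.
split; [split; [|split]|split] => /=.
- by do !split; auto.
- by move=> X /=; tauto.
- by do !split.
- by do !split; do ?constructor.
- exists lengths_labels; split; last by do !split.
  by case=> [|n]; do ?constructor.
Qed.

Lemma same_lengths_body_sem A (nx : A -> A) (tst : tests AP A) W v N :
  let a := tst (TNext DirG (TNot (TAp x0))) 0 in
  (forall j, j < N -> ~ a (iter j nx v)) -> a (iter N nx v) ->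
  gsem nx tst W same_lengths_body v <->
  tst (TNext DirG (TNext DirG (TAp x0))) 1 (iter N nx v).
Proof.
move=> a; set b := tst _ 1.
have unfold u : gsem nx tst W same_lengths_body u <->
    a u /\ b u \/ ~ a u /\ gsem nx tst W same_lengths_body (nx u).
  rewrite {1}/same_lengths_body gsem_muE; last by do !split.
  by rewrite -/same_lengths_body mOr_sem !mAnd_sem [gsem _ _ _ (MNext _ _) _]/= upd_eq.
elim: N v => [|N IH] v nA AN; rewrite unfold; first by move: AN => /=; tauto.
rewrite IH.
- by have := nA 0 isT; rewrite iterSr /=; tauto.
- by move=> j jN; rewrite -iterSr; apply: nA.
- by rewrite -iterSr.
Qed.

Lemma same_lengths_wave a n : n + 2 <= a ->
  models (@mum_step AP) (fun t => t = shift (wave a) n) same_lengths <-> n = 0.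
Proof.
move=> na; set tr := shift (wave a) n.
have lab i : (tr i).1 = if (i + n) %% (2 * a) < a then [set x0] else set0 by [].
have ones i : i + n < a -> x0 \in (tr i).1.
  by move=> h; rewrite lab modn_small ?h ?inE //; lia.
have zeros i : a <= i + n < 2 * a -> x0 \notin (tr i).1.
  by move=> h; rewrite lab modn_small ?ifF ?inE //; lia.
rewrite /models /=; pose Pi := upd (upd (fun _ => default_trace AP) 0 tr) 1 tr.
transitivity (msem (@mum_step AP) Pi (fun _ _ => False) same_lengths_body (fun _ => 0)).
  by split=> [[t [-> [t' [->]]]]//|h]; exists tr; split=> //; exists tr.
rewrite (msem_mum (D := lengths_labels)); last by do !split.
set nx := fun v pi => _.
have head0 j : j < a - n -> iter j nx (fun _ => 0) 0 = j.
  elim: j => //= j IH jn; rewrite /nx IH; last by lia.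
  by apply: next_posE; left; split=> //; split; [apply: ones; lia|lia].
have head1 j : j < a - n -> iter j.+1 nx (fun _ => 0) 1 = a - n + j.
  elim: j => [|j IH] jn; rewrite iterS {1}/nx.
    apply: next_posE; left; split; first by rewrite /=; lia.
    split; first by apply/negP/zeros; lia.
    by move=> k /= kb; apply; apply: ones; lia.
  rewrite IH; last by lia.
  by apply: next_posE; left; split; [lia|split; [apply/negP/zeros; lia|lia]].
have Pi0 : Pi 0 = tr by [].
have Pi1 : Pi 1 = tr by [].
(* Head 0 is about to leave its block after [a - n - 1] steps. This is positive by [n + 2 <= a], as
   [head1] describes head 1 only after its first step. *)
have EN : a - n - 1 = (a - n - 2).+1 by lia.
rewrite (@same_lengths_body_sem _ _ _ _ _ (a - n - 1)).
- rewrite /head_tests Pi1 !tNext_sem EN head1 /=; last by lia.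
  split=> [|n0]; last first.
    (* Two positions past head 1 is position [2 * a - n] of the wave: the start of a block of ones
       if [n = 0], and inside the zeros otherwise. *)
    rewrite (_ : _ + n = 2 * a); last by lia.
    by rewrite modnn ifT ?inE //; lia.
  apply: contraPP => n0; apply/negP/zeros; lia.
- move=> j jN; rewrite /head_tests Pi0 tNext_sem head0; last by lia.
  by move=> /=; apply; apply: ones; lia.
- rewrite /head_tests Pi0 tNext_sem head0; last by lia.
  by apply/negP/zeros; lia.
Qed.

Lemma shift0 tr : shift tr 0 = tr.
Proof. by apply: funext => i; rewrite /shift addn0. Qed.

Lemma stuttering_not_at_least_mumbling :
  ~ at_least_as_expressive (@stut_step AP) (@StutLTLUnique AP)
      (@mum_step AP) (@MumLTLUnique AP).
Proof.
move=> /(_ _ same_lengths_unique) [phi [uphi E]].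
have [a [n [n0 na]]] := stuttering_blind uphi; rewrite !E.
rewrite same_lengths_wave // -{1}[wave a]shift0 same_lengths_wave; last by lia.
by lia.
Qed.

End Separation.

Theorem theorem6p4 (AP : finType) (hAP : inhabited AP) :
  strictly_more_expressive
    (@mum_step AP) (@MumLTLUnique AP)
    (@stut_step AP) (@StutLTLUnique AP).
Proof.
have [x0] := hAP; split; first exact: mumbling_at_least_stuttering x0.
exact: stuttering_not_at_least_mumbling x0.
Qed.
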